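(* Let $K$ be a field, let $0<a<b<c$ be integers, and let $I=(x^c,\,x^by^a,\,x^ay^b,\,y^c)\subset K[x,y]$ be the symmetric ideal attached to this sequence. If $b=a+1$, then the fiber cone $F(I)$ is Cohen--Macaulay for all $c$.
   Context: With $\mathfrak m=(x,y)\subset K[x,y]$, the fiber cone of $I$ is the standard graded $K$-algebra $F(I)=\bigoplus_{k\ge0}I^k/\mathfrak mI^k$. *)

(* Defs.v *)
From HB Require Import structures.
From mathcomp Require Import all_boot all_order all_algebra.
From mathcomp Require Import boolp.
From mathcomp Require Import mpoly.
Set Implicit Arguments.
Unset Strict Implicit.
Unset Printing Implicit Defensive.
Import GRing.Theory.
Local Open Scope ring_scope.
Local Open Scope quotient_scope.

Section IdealOperations.
Variable R : comNzRingType.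
Implicit Types (S I J : {pred R}) (x y z : R).

Definition ideal_gen S : {pred R} :=
  [pred x | `[< exists2 t : seq (R * R), all (fun u => u.2 \in S) t
                & x = \sum_(u <- t) u.1 * u.2 >]].

Definition ideal_mul I J : {pred R} :=
  ideal_gen [pred z | `[< exists x y, [/\ x \in I, y \in J & z = x * y] >]].

Definition ideal_exp I k : {pred R} := iter k (ideal_mul I) predT.

Lemma ideal_gen0 S : 0 \in ideal_gen S.
Proof. by apply/asboolP; exists [::]; rewrite ?big_nil. Qed.

Lemma ideal_genD S : {in ideal_gen S &, forall x y, x + y \in ideal_gen S}.
Proof.
move=> x y /asboolP[s Ss ->] /asboolP[t St ->]; apply/asboolP.
by exists (s ++ t); rewrite ?all_cat ?Ss ?big_cat.
Qed.

Lemma ideal_genM S a : {in ideal_gen S, forall x, a * x \in ideal_gen S}.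
Proof.
move=> x /asboolP[s Ss ->]; apply/asboolP.
exists [seq (a * u.1, u.2) | u <- s]; first by rewrite all_map.
by rewrite big_map mulr_sumr; apply: eq_bigr => u _; rewrite mulrA.
Qed.

Lemma ideal_genN S : {in ideal_gen S, forall x, - x \in ideal_gen S}.
Proof. by move=> x Sx; rewrite -mulN1r ideal_genM. Qed.

Lemma mem_ideal_gen S : {subset S <= ideal_gen S}.
Proof.
move=> x Sx; apply/asboolP; exists [:: (1, x)]; rewrite /= ?Sx //.
by rewrite big_seq1 mul1r.
Qed.

(* [ideal_gen S] is the least ideal containing [S]. *)
Lemma ideal_gen_min S J :
  0 \in J -> {in J &, forall x y, x + y \in J} ->
  (forall a, {in J, forall x, a * x \in J}) ->
  {subset S <= J} -> {subset ideal_gen S <= J}.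
Proof.
move=> J0 JD JM SJ x /asboolP[t St ->].
elim: t St => [|u t IHt] /=; first by rewrite big_nil.
by case/andP=> Su St; rewrite big_cons JD ?IHt // JM // SJ.
Qed.

Lemma mem_ideal_mul I J :
  {in I & J, forall x y, x * y \in ideal_mul I J}.
Proof.
by move=> x y Ix Jy; apply: mem_ideal_gen; apply/asboolP; exists x, y.
Qed.

Lemma ideal_mul_min I J (T : {pred R}) :
  0 \in T -> {in T &, forall x y, x + y \in T} ->
  (forall a, {in T, forall x, a * x \in T}) ->
  {in I & J, forall x y, x * y \in T} -> {subset ideal_mul I J <= T}.
Proof.
move=> T0 TD TM IJT; apply: ideal_gen_min => // _ /asboolP[x [y [Ix Jy ->]]].
exact: IJT.
Qed.

Lemma ideal_exp0_mem I k : 0 \in ideal_exp I k.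
Proof. by case: k => [|k] //; apply: ideal_gen0. Qed.

Lemma ideal_expDr I k : {in ideal_exp I k &, forall x y, x + y \in ideal_exp I k}.
Proof. by case: k => [|k] //; apply: ideal_genD. Qed.

Lemma ideal_expMl I k a : {in ideal_exp I k, forall x, a * x \in ideal_exp I k}.
Proof. by case: k => [|k] //; apply: ideal_genM. Qed.

Lemma ideal_expNr I k : {in ideal_exp I k, forall x, - x \in ideal_exp I k}.
Proof. by case: k => [|k] //; apply: ideal_genN. Qed.

Lemma ideal_exp_add I j k :
  {in ideal_exp I j & ideal_exp I k, forall x y, x * y \in ideal_exp I (j + k)}.
Proof.
elim: j => [|j IHj] x y; first by move=> _ Iy; apply: ideal_expMl.
move=> Ix Iy; rewrite addSn; move: x Ix; rewrite /ideal_exp /= -/(ideal_exp I j).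
move=> x Ix; pose T := [pred z | z * y \in ideal_mul I (ideal_exp I (j + k))].
have TE z : (z \in T) = (z * y \in ideal_mul I (ideal_exp I (j + k))) by [].
suff /(_ x Ix) : {subset ideal_mul I (ideal_exp I j) <= T} by [].
apply: ideal_mul_min => [|u v|b u|u v Iu Jv]; rewrite !TE.
- by rewrite mul0r ideal_gen0.
- by rewrite mulrDl; apply: ideal_genD.
- by rewrite -mulrA; apply: ideal_genM.
by rewrite -mulrA mem_ideal_mul ?IHj.
Qed.

End IdealOperations.

Section ReesAlgebra.
Variables (R : comNzRingType) (I : {pred R}).

(* The Rees algebra R[It], the direct sum of the I^k t^k, as a subring of
   R[t]. *)
Definition rees_pred : {pred {poly R}} :=
  [pred p : {poly R} | `[< forall k, p`_k \in ideal_exp I k >]].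

Fact rees_subring_closed : subring_closed rees_pred.
Proof.
split=> [|p q /asboolP Ip /asboolP Iq|p q /asboolP Ip /asboolP Iq].
- by apply/asboolP=> -[|k]; rewrite coef1 // ideal_exp0_mem.
- by apply/asboolP=> k; rewrite coefB ideal_expDr ?ideal_expNr.
apply/asboolP=> k; rewrite coefM.
apply: (big_ind (fun x => x \in ideal_exp I k)) => [||i _].
- exact: ideal_exp0_mem.
- by move=> x y; apply: ideal_expDr.
by have := ideal_exp_add (Ip i) (Iq (k - i)%N); rewrite (subnKC (leq_ord i)).
Qed.

HB.instance Definition _ :=
  GRing.isSubringClosed.Build {poly R} rees_pred rees_subring_closed.

Record rees := Rees { rees_val :> {poly R}; _ : rees_val \in rees_pred }.

HB.instance Definition _ := [isSub for rees_val].
HB.instance Definition _ := [Choice of rees by <:].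
HB.instance Definition _ := [SubChoice_isSubComNzRing of rees by <:].

Lemma rees_coef (p : rees) k : (val p)`_k \in ideal_exp I k.
Proof. by have /asboolP/(_ k) := valP p. Qed.

End ReesAlgebra.

Section FiberCone.
Variable K : fieldType.
Local Notation S := {mpoly K[2]}.

Definition vx : S := 'X_ord0.
Definition vy : S := 'X_ord_max.

Definition mxy : {pred S} := ideal_gen (mem [:: vx; vy]).

Variable I : {pred S}.

(* The homogeneous ideal of the Rees algebra whose component of degree k is
   m I^k. *)
Definition mrees : {pred rees I} :=
  [pred p : rees I | `[< forall k, (val p)`_k \in ideal_mul mxy (ideal_exp I k) >]].

Fact mrees_idealr_closed : idealr_closed mrees.
Proof.
split.
- by apply/asboolP=> k; rewrite raddf0 coef0; apply: ideal_gen0.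
- apply/negP=> /asboolP/(_ 0); rewrite rmorph1 coef1 eqxx => m1.
  suff: {subset ideal_mul mxy (ideal_exp I 0) <= [pred p : S | p@_0%MM == 0]}.
    by move=> /(_ _ m1); rewrite inE mcoeff1 eqxx oner_eq0.
  have mM a : {in [pred p : S | p@_0%MM == 0],
      forall p, a * p \in [pred p : S | p@_0%MM == 0]}.
    by move=> p; rewrite !inE rmorphM /= => /eqP->; rewrite mulr0.
  have mD : {in [pred p : S | p@_0%MM == 0] &,
      forall p q, p + q \in [pred p : S | p@_0%MM == 0]}.
    by move=> p q; rewrite !inE raddfD /= => /eqP-> /eqP->; rewrite addr0.
  apply: ideal_mul_min => //; rewrite ?inE ?raddf0 // => p q mp _.
  rewrite mulrC mM //; move: p mp; apply: ideal_gen_min => //.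
    by rewrite inE raddf0.
  by move=> p; rewrite !inE => /orP[]/eqP->; rewrite mcoeffX mnm1_eq0.
move=> a p q /asboolP mp /asboolP mq; apply/asboolP=> k.
rewrite raddfD /= coefD; apply: ideal_genD => //.
rewrite coefM.
apply: (big_ind (fun x => x \in ideal_mul mxy (ideal_exp I k))) => [||i _].
- exact: ideal_gen0.
- by move=> x y; apply: ideal_genD.
set x := _`_i; have Ix : x \in ideal_exp I i := rees_coef a i.
rewrite -[X in ideal_exp I X](subnKC (leq_ord i)).
pose T := [pred z | x * z \in ideal_mul mxy (ideal_exp I (i + (k - i)))].
have TE z : (z \in T) = (x * z \in ideal_mul mxy (ideal_exp I (i + (k - i)))).
  by [].
suff: {subset ideal_mul mxy (ideal_exp I (k - i)) <= T} by move=> /(_ _ (mp _)).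
apply: ideal_mul_min => [|u v|b u|u v mu Iv]; rewrite !TE.
- by rewrite mulr0 ideal_gen0.
- by rewrite mulrDr; apply: ideal_genD.
- by rewrite mulrCA; apply: ideal_genM.
by rewrite mulrCA mem_ideal_mul // ideal_exp_add.
Qed.

HB.instance Definition _ := isIdealr.Build (rees I) mrees mrees_idealr_closed.

(* F(I) is the quotient of the direct sum of the I^k by the direct sum of the
   m I^k; this quotient carries the ring structure. *)
Definition fiber_cone : comNzRingType := {ideal_quot mrees}.

Definition to_fiber_cone (p : rees I) : fiber_cone := \pi_({ideal_quot mrees}) p.

Lemma to_fiber_cone_eq (p q : rees I) :
  to_fiber_cone p = to_fiber_cone q <->
  forall k, (val p)`_k - (val q)`_k \in ideal_mul mxy (ideal_exp I k).
Proof.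
split=> [/eqP|pq].
  rewrite /to_fiber_cone -Quotient.idealrBE => /asboolP pq k.
  by have := pq k; rewrite raddfB coefB.
apply/eqP; rewrite /to_fiber_cone -Quotient.idealrBE; apply/asboolP=> k.
by rewrite raddfB coefB.
Qed.

(* The graded maximal ideal: the direct sum of the components of degree
   k > 0. *)
Definition fiber_cone_plus : {pred fiber_cone} :=
  [pred f | `[< exists2 p : rees I, (val p)`_0 = 0 & f = to_fiber_cone p >]].

End FiberCone.

Section DepthAndDimension.
Variable A : comNzRingType.

Definition prime_ideal (P : {pred A}) : Prop :=
  idealr_closed P /\ prime_idealr_closed P.

(* A chain P_0 < ... < P_n, of length n; the values P_i with i > n are
   irrelevant. *)
Definition prime_chain (n : nat) (P : nat -> {pred A}) : Prop :=
  (forall i, (i <= n)%N -> prime_ideal (P i)) /\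
  (forall i, (i < n)%N ->
     {subset P i <= P i.+1} /\ exists2 f, f \in P i.+1 & f \notin P i).

Definition krull_dim (d : nat) : Prop :=
  (exists P, prime_chain d P) /\
  (forall n P, prime_chain n P -> (n <= d)%N).

Definition regular_sequence (s : seq A) : Prop :=
  (forall i, (i < size s)%N -> forall f : A,
     f * s`_i \in ideal_gen (mem (take i s)) ->
     f \in ideal_gen (mem (take i s))) /\
  1 \notin ideal_gen (mem s).

Definition depth (M : {pred A}) (d : nat) : Prop :=
  (exists s : seq A, [/\ {subset s <= M}, regular_sequence s & size s = d]) /\
  (forall s : seq A, {subset s <= M} -> regular_sequence s -> (size s <= d)%N).

(* For a standard graded algebra A over a field, with graded maximal ideal M:
   depth A = dim A. *)
Definition graded_cohen_macaulay (M : {pred A}) : Prop :=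
  exists d, depth M d /\ krull_dim d.

End DepthAndDimension.

Definition symmetric_ideal (K : fieldType) (a b c : nat) : {pred {mpoly K[2]}} :=
  let x := vx K in let y := vy K in
  ideal_gen (mem [:: x ^+ c; x ^+ b * y ^+ a; x ^+ a * y ^+ b; y ^+ c]).
Arguments symmetric_ideal : clear implicits.
Arguments fiber_cone_plus {K} I.

(* Main.v *)
Require Import Defs.
From mathcomp Require Import all_boot all_order all_algebra.
From mathcomp Require Import boolp mpoly ring zify.
Set Implicit Arguments.
Unset Strict Implicit.
Unset Printing Implicit Defensive.
Import GRing.Theory.

(** Write z1, z2, z3, z4 for the classes in degree 1 of x^c, x^(a+1) y^a,
    x^a y^(a+1), y^c, and call an exponent vector w in N^4 a word, standing for
    the product of the generators with exponents w.  The fiber cone has as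
    K-basis the minimal monomial generators of all the powers I^k, and a
    product of basis elements is again one or is zero.  So F(I) is known once
    each minimal generator has been given a normal form as a word.  With the
    hypothesis c >= a + 2, three presentations occur:

    - c <= 2a: any product of two of z2, z3 is zero, since
      x^c y^c strictly divides the monomial it stands for;
    - c = 2a + 1: z2 z3 = z1 z4, z2^(a+1) = z1 z3^a, z3^(a+1) = z2^a z4 (the
      cone over a monomial curve);
    - c > 2a + 1: z1 z4 = z1 z3^a = z2^a z4 = 0.

    In each case the left-hand sides generate the monomials that are not normal
    forms.  That normal forms dominate every word is a rewriting argument
    ([standard_dominating]); that two distinct ones of the same degree never divide
    each other is arithmetic ([antichain_small], [antichain_balanced],
    [antichain_large]).  These two facts give the coordinates [ncoef] on F(I)
    and the multiplication rule [ncoef_monoM], which is all that is used about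
    the ring.

    Depth at least 2.  If c <= 2a + 1, multiplication by z1 or z4 shifts normal
    forms, so F(I) is free over K[z1, z4] and z1, z4 is regular
    ([free_regular_pair]).  If c > 2a + 1, the spectrum has three components,
    with coordinates z1, z2, then z2, z3, then z3, z4, so that sums are needed:
    z1 + z3^a, z4 + z2^a is regular ([binomial_regular_pair]).  The exponent a
    makes the two terms of each sum kill each other, z1 z3^a = 0 and
    z2^a z4 = 0, and every coordinate computation is then one line.

    Depth and dimension at most 2.  Both follow from the same kind of identity
      x0^i (x1^j (x2^k (unit + x2 r2) + x1 r1) + x0 r0) = 0
    for arbitrary x0, x1, x2 in the ring: against a chain of primes or along a
    regular sequence it unwinds factor by factor until a unit is trapped in a
    proper ideal ([prime_chain_boundary], [regular_sequence_boundary]).  The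
    identity is a nontrivial polynomial relation over K, factored at its lowest
    monomial in the lexicographic order.  Such a relation exists by counting:
    minimal generators of I^k have distinct x-degrees, at most ck, so the first
    N components of F(I) have total dimension O(N^2), while there are N^3
    monomials in x0, x1, x2 ([rees_dependent]).

    Dimension at least 2.  A weight on x and y that is minimal along a face of
    the Newton polygon of I defines a prime of F(I), because taking the parts of
    minimal weight is a ring morphism to a domain ([face_primeP]).  An edge, a
    vertex of it, and the weight that only sees degree 0 give a chain of length
    2. *)

(** * Bounding depth and dimension by an identity *)
Section BoundaryIdentities.
Local Open Scope ring_scope.
Variable A : comNzRingType.
Implicit Types (x v : A) (s : seq A).

(** Elements of the shape x0^i (x1^j ( ... (unit + ...) ... + x1 r1) + x0 r0),
    for s = [x0; x1; ...].  That 0 has this shape for every s of size d + 1 is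
    the first-order form of having Krull dimension at most d (Coquand and
    Lombardi). *)
Fixpoint iterated_boundary s v : Prop :=
  if s is x :: s' then
    exists n q v', iterated_boundary s' v' /\ v = x ^+ n * (v' + x * q)
  else exists v', v' * v = 1.

(** Factoring a polynomial in x at its first nonzero coefficient.  The predicate
    C remembers the coefficients that vanish formally, so that iterating
    over several variables ends with either a zero polynomial or the nested
    shape. *)
Lemma iterated_boundary_sum (C : nat -> Prop) x s (phi : nat -> A) N :
    (forall i, (i < N)%N -> (C i /\ phi i = 0) \/ iterated_boundary s (phi i)) ->
  ((forall i, (i < N)%N -> C i) /\ \sum_(i < N) phi i * x ^+ i = 0)
  \/ iterated_boundary (x :: s) (\sum_(i < N) phi i * x ^+ i).
Proof.
elim: N phi C => [|N IHN] phi C phiP; first by left; rewrite big_ord0.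
have [||] := IHN (fun i => phi i.+1) (fun i => C i.+1).
- by move=> i ltiN; apply: phiP.
- move=> [CS sum0]; rewrite big_ord_recl expr0 mulr1.
  have sumE : \sum_(i < N) phi (lift ord0 i) * x ^+ lift ord0 i = 0.
    under eq_bigr => i _ do rewrite lift0 exprS mulrCA.
    by rewrite -mulr_sumr sum0 mulr0.
  case: (phiP 0%N isT) => [[C0 phi0]|bd0].
    left; split=> [[|i] lti|]; [exact: C0 | exact: CS |].
    by rewrite sumE addr0 [LHS]phi0.
  by right; exists 0%N, 0, (phi 0%N); rewrite sumE expr0 mul1r mulr0.
move=> [n [q [v [bdv sumv]]]]; right.
have sumE : \sum_(i < N.+1) phi i * x ^+ i = phi 0%N + x ^+ n.+1 * (v + x * q).
  rewrite big_ord_recl expr0 mulr1 exprS -mulrA -sumv; congr (_ + _).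
  by rewrite mulr_sumr; apply: eq_bigr => i _; rewrite lift0 exprS mulrCA.
case: (phiP 0%N isT) => [[C0 phi0]|bd0].
  by exists n.+1, q, v; rewrite sumE phi0 add0r.
exists 0%N, (x ^+ n * (v + x * q)), (phi 0%N).
by rewrite sumE expr0 mul1r exprS mulrA.
Qed.

(** With x0 outside P_0, primality removes the power of x0, and x0 in P_1 then
    removes the summand x0 r0: the inner expression would be in P_1.  At the end
    of the chain a unit would be in a prime. *)
Lemma prime_chain_boundary (P : nat -> {pred A}) s v :
    prime_chain (size s) P -> iterated_boundary s v ->
    (forall i, (i < size s)%N -> s`_i \in P i.+1 /\ s`_i \notin P i) ->
  v \notin P 0%N.
Proof.
elim: s P v => [|x s IHs] P v /= [primeP chainP].
  case=> v' v'v _; apply/negP => Pv.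
  have [[P0 P1 PD] _] := primeP 0%N isT.
  by case/negP: P1; rewrite -v'v -[_ * _]addr0 PD.
case=> [k [q [v' [bdv' ->]]]] sP.
have v'P : v' \notin P 1%N.
  apply: (IHs (fun i => P i.+1)) => //.
    by split=> i lti; [apply: primeP | apply: chainP].
  by move=> i lti; apply: (sP i.+1).
have [x1 x0] := sP 0%N isT; rewrite /= in x1 x0.
apply/negP => Pprod; have [[P00 P01 P0D] P0prime] := primeP 0%N isT.
have [sub01 _] := chainP 0%N isT.
have {Pprod} Psum : v' + x * q \in P 0%N.
  elim: k Pprod => [|k IHk]; first by rewrite expr0 mul1r.
  rewrite exprS -mulrA => /P0prime/orP[xP|]; last exact: IHk.
  by rewrite xP in x0.
case/negP: v'P; have [[P10 P11 P1D] _] := primeP 1%N isT.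
have -> : v' = (- q) * x + (v' + x * q) by ring.
exact: P1D x1 (sub01 _ Psum).
Qed.

Lemma krull_dim_bound d :
    (forall s, size s = d.+1 -> iterated_boundary s 0) ->
  forall n (P : nat -> {pred A}), prime_chain n P -> (n <= d)%N.
Proof.
move=> bd n P [primeP chainP]; rewrite leqNgt; apply/negP => ltdn.
have sP i : exists x, (i < n)%N -> x \in P i.+1 /\ x \notin P i.
  have [lti|_] := ltnP i n; last by exists 0.
  by have [_ [f f1 f0]] := chainP i lti; exists f.
have /choice[f fP] := sP.
have : 0 \notin P 0%N.
  apply: (@prime_chain_boundary P (mkseq f d.+1)); rewrite ?size_mkseq.
  - by split=> i lti; [apply: primeP | apply: chainP]; apply: leq_trans lti _.
  - by apply: bd; rewrite size_mkseq.
  - by move=> i lti; rewrite nth_mkseq //; apply: fP; apply: leq_trans lti _.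
by have [[-> _ _] _] := primeP 0%N isT.
Qed.

(** The same unwinding, with regularity of x modulo s1 in place of primality. *)
Lemma regular_sequence_boundary s1 s2 v :
    regular_sequence (s1 ++ s2) -> iterated_boundary s2 v ->
    v \in ideal_gen (mem s1) ->
  1 \in ideal_gen (mem (s1 ++ s2)).
Proof.
elim: s2 s1 v => [|x s2 IHs2] s1 v regs /=.
  by case=> v' v'v s1v; rewrite cats0 -v'v ideal_genM.
case=> n [q [v' [bdv' ->]]] s1prod; rewrite -cat_rcons.
apply: (IHs2 _ v') => //; first by rewrite cat_rcons.
have {s1prod} s1sum : v' + x * q \in ideal_gen (mem s1).
  elim: n s1prod => [|n IHn]; first by rewrite expr0 mul1r.
  rewrite exprS -mulrA mulrC => s1prod; apply: IHn.
  have [regx _] := regs; have := regx (size s1).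
  rewrite size_cat addnS ltnS leq_addr => /(_ isT (x ^+ n * (v' + x * q))).
  by rewrite take_size_cat // nth_cat ltnn subnn; apply.
have -> : v' = (- q) * x + (v' + x * q) by ring.
have sub_rcons y : y \in x :: s1 -> y \in ideal_gen (mem (rcons s1 x)).
  by rewrite -mem_rcons => ys; apply: mem_ideal_gen.
apply: ideal_genD; first by rewrite ideal_genM ?sub_rcons ?mem_head.
move: s1sum; apply: ideal_gen_min; first exact: ideal_gen0.
- exact: ideal_genD.
- exact: ideal_genM.
by move=> y ys1; apply: sub_rcons; rewrite in_cons orbC [y \in s1]ys1.
Qed.

Lemma regular_sequence_bound d :
    (forall s, size s = d.+1 -> iterated_boundary s 0) ->
  forall s, regular_sequence s -> (size s <= d)%N.
Proof.
move=> bd s [regs s1]; rewrite leqNgt; apply/negP => ltds.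
have szt : size (take d.+1 s) = d.+1 by rewrite size_takel.
have ts_s y : y \in take d.+1 s -> y \in s by apply: mem_take.
have sub_gen : {subset ideal_gen (mem (take d.+1 s)) <= ideal_gen (mem s)}.
  apply: ideal_gen_min; first exact: ideal_gen0.
  - exact: ideal_genD.
  - exact: ideal_genM.
  by move=> y /ts_s ys; apply: mem_ideal_gen.
apply: (negP s1); apply: (sub_gen).
apply: (@regular_sequence_boundary [::] _ 0); rewrite ?ideal_gen0 //=; last exact: bd.
split=> [i|]; last by apply: contra s1 => /sub_gen.
rewrite szt => lti f; rewrite nth_take // take_takel 1?ltnW //.
by apply: regs; apply: leq_trans ltds.
Qed.

End BoundaryIdentities.

(** * Linear systems with more unknowns than equations *)
Section LinearAlgebra.
Local Open Scope ring_scope.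

Lemma exists_nontrivial_solution (K : fieldType) (X Y : finType) (M : X -> Y -> K) :
    (#|Y| < #|X|)%N ->
  exists lam : X -> K, (exists x, lam x != 0) /\
    forall y, \sum_x lam x * M x y = 0.
Proof.
move=> ltYX; pose B : 'M_(#|X|, #|Y|) := \matrix_(i, j) M (enum_val i) (enum_val j).
have : kermx B != 0.
  rewrite kermx_eq0 /row_free; apply/eqP => rB.
  by have := rank_leq_col B; rewrite rB leqNgt ltYX.
case/rowV0Pn => u /sub_kermxP uB u0.
exists (fun x => u 0 (enum_rank x)); split.
  case/rV0Pn: u0 => j uj; exists (enum_val j); by rewrite enum_valK.
move=> y; move/matrixP/(_ 0 (enum_rank y)): uB; rewrite !mxE; apply: etrans.
rewrite (reindex (@enum_val X X)) /=; last first.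
  by exists enum_rank => z _; rewrite ?enum_valK ?enum_rankK.
by apply: eq_bigr => i _; rewrite !mxE enum_valK enum_rankK.
Qed.

End LinearAlgebra.

(** * Powers of a monomial ideal in two variables *)
Section Exponents.
Variables (n : nat) (e : 'I_n -> 'X_{1..2}).
Implicit Types (u w : 'X_{1..n}) (m d : 'X_{1..2}).

Definition expo w : 'X_{1..2} := (\sum_(i < n) e i *+ w i)%MM.

Lemma expoE w j : expo w j = \sum_(i < n) e i j * w i.
Proof. by rewrite mnm_sumE; apply: eq_bigr => i _; rewrite mulmnE. Qed.

Lemma expo0 : expo 0%MM = 0%MM.
Proof. by apply/mnmP=> j; rewrite expoE mnm0E big1 // => i _; rewrite mnm0E muln0. Qed.

Lemma expoD u w : expo (u + w)%MM = (expo u + expo w)%MM.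
Proof.
apply/mnmP=> j; rewrite mnmDE !expoE -big_split.
by apply: eq_bigr => i _; rewrite mnmDE mulnDr.
Qed.

Lemma expoU i : expo U_(i)%MM = e i.
Proof.
apply/mnmP=> j; rewrite expoE (bigD1 i) //= big1 ?mnm1E ?eqxx ?muln1 ?addn0 //.
by move=> k ki; rewrite mnm1E eq_sym (negPf ki) muln0.
Qed.

End Exponents.

Lemma lem_anti n (u w : 'X_{1..n}) : (u <= w)%MM -> (w <= u)%MM -> u = w.
Proof.
by move=> /mnm_lepP uw /mnm_lepP wu; apply/mnmP => i; apply/eqP; rewrite eqn_leq uw wu.
Qed.

Lemma lem2E (m m' : 'X_{1..2}) :
  (m <= m')%MM = (m ord0 <= m' ord0) && (m ord_max <= m' ord_max).
Proof.
apply/mnm_lepP/andP => [le|[le0 le1]] => [|i]; first by split; apply: le.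
have [/eqP/val_inj ->|/val_inj ->] : (val i == val (@ord0 1)) \/ val i = val (@ord_max 1).
- by case: i => [[|[|//]] ?]; [left | right].
- exact: le0.
- exact: le1.
Qed.

Section SupportIdeals.
Local Open Scope ring_scope.
Variable K : fieldType.
Local Notation S := {mpoly K[2]}.
Implicit Types (m d : 'X_{1..2}) (p q : S) (E F G : 'X_{1..2} -> Prop).

(** The span of the monomials in E; an ideal when E is stable under shifts. *)
Definition supported E : {pred S} := [pred p | `[< forall m, p@_m != 0 -> E m >]].

Definition shift_stable E := forall m d, E m -> E (d + m)%MM.

Lemma supported0 E : 0 \in supported E.
Proof. by apply/asboolP => m; rewrite mcoeff0 eqxx. Qed.

Lemma supportedD E : {in supported E &, forall p q, p + q \in supported E}.
Proof.
move=> p q /asboolP Ep /asboolP Eq; apply/asboolP => m; rewrite mcoeffD => pq.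
have [p0|] := eqVneq p@_m 0; last exact: Ep.
by apply: Eq; apply: contra_neq pq => ->; rewrite p0 addr0.
Qed.

Lemma supportedM E F G : (forall m d, E m -> F d -> G (m + d)%MM) ->
  {in supported E & supported F, forall p q, p * q \in supported G}.
Proof.
move=> EFG p q /asboolP Ep /asboolP Fq; apply/asboolP => m.
rewrite -mcoeff_msupp => /msuppM_le/allpairsP[[m1 m2] /= [m1p m2q ->]].
by apply: EFG; [apply: Ep | apply: Fq]; rewrite -mcoeff_msupp.
Qed.

Lemma supportedX E m : ('X_[m] \in supported E) <-> E m.
Proof.
split=> [/asboolP/(_ m)|Em]; first by rewrite mcoeffX eqxx oner_eq0; apply.
by apply/asboolP => d; rewrite mcoeffX; case: (eqVneq m d) => [<-|]; rewrite ?eqxx.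
Qed.

Lemma supportedMl E : shift_stable E ->
  forall a, {in supported E, forall p, a * p \in supported E}.
Proof.
move=> Es a p Ep; apply: (@supportedM (fun=> True) E) => //.
  by move=> m d _; apply: Es.
by apply/asboolP.
Qed.

Lemma supported_min E (J : {pred S}) :
  0 \in J -> {in J &, forall x y, x + y \in J} ->
  (forall a, {in J, forall x, a * x \in J}) ->
  (forall m, E m -> 'X_[m] \in J) -> {subset supported E <= J}.
Proof.
move=> J0 JD JM EJ p /asboolP Ep; rewrite [p]mpolyE big_seq.
apply: (big_ind (fun x => x \in J)) => // m mp.
by rewrite -mul_mpolyC JM //; apply/EJ/Ep; rewrite -mcoeff_msupp.
Qed.

End SupportIdeals.
Arguments supported K E : clear implicits.

Section MonomialIdeal.
Local Open Scope ring_scope.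
Variables (K : fieldType) (n : nat) (e : 'I_n -> 'X_{1..2}).
Local Notation S := {mpoly K[2]}.
Implicit Types (u w : 'X_{1..n}) (m d : 'X_{1..2}) (p q : S).

Definition mon_ideal : {pred S} := ideal_gen (mem [seq 'X_[e i] | i <- enum 'I_n]).

(** The monomials of I^k and, below, those of m I^k: the exponents strictly
    above some word of degree k. *)
Definition above k m := exists u, mdeg u = k /\ (expo e u <= m)%MM.
Definition strictly_above k m :=
  exists u, [/\ mdeg u = k, (expo e u <= m)%MM & expo e u != m].

Lemma above_shift k : shift_stable (above k).
Proof.
move=> m d [u [uk um]]; exists u; split=> //.
by apply: lepm_trans um _; apply: lem_addl.
Qed.

Lemma strictly_above_shift k : shift_stable (strictly_above k).
Proof.
move=> m d [u [uk um eum]]; exists u; split=> //.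
  by apply: lepm_trans um _; apply: lem_addl.
apply: contra_neq eum => eum; apply: lem_anti => //.
by rewrite eum lem_addl.
Qed.

(** One inclusion multiplies supports; the other splits a letter off a word of
    degree k + 1. *)
Lemma mem_ideal_exp k : ideal_exp mon_ideal k =i supported K (above k).
Proof.
elim: k => [|k IHk] p; apply/idP/idP.
- move=> _; apply/asboolP => m _; exists 0%MM; rewrite mdeg0 expo0; split=> //.
  by apply/mnm_lepP => i; rewrite mnm0E.
- by [].
- move: p; apply: ideal_mul_min.
  + exact: supported0.
  + exact: supportedD.
  + exact/supportedMl/above_shift.
  move=> x y xI; rewrite IHk; move: x y xI.
  suff sub1 : {subset mon_ideal <= supported K (above 1)}.
    move=> x y /sub1 x1 yk; apply: supportedM x1 yk => m d [u [u1 um]] [w [wk wd]].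
    exists (u + w)%MM; rewrite mdegD u1 wk expoD; split=> //.
    apply/mnm_lepP => i; rewrite !mnmDE leq_add //; exact/mnm_lepP.
  apply: ideal_gen_min.
  + exact: supported0.
  + exact: supportedD.
  + exact/supportedMl/above_shift.
  move=> _ /mapP[i _ ->]; apply/supportedX; exists U_(i)%MM.
  by rewrite mdeg1 expoU lepm_refl.
move: p; apply: supported_min.
- exact: ideal_gen0.
- exact: ideal_genD.
- exact: ideal_genM.
move=> m [u [uk um]].
have [i ui] : exists i, u i != 0%N.
  case: (pickP (fun i => u i != 0%N)) => [i ui|u0]; first by exists i.
  by move: uk; rewrite mdegE big1 // => i _; apply/eqP; have := u0 i; case: eqP.
have /submK uE : (U_(i) <= u)%MM by rewrite lep1mP.
have eim : (e i <= m)%MM.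
  by apply: lepm_trans um; rewrite -uE expoD expoU lem_addl.
rewrite -(submK eim) addmC mpolyXD mem_ideal_mul //.
  by apply/mem_ideal_gen/map_f; rewrite mem_enum.
rewrite IHk; apply/supportedX; exists (u - U_(i))%MM; split.
  by apply: succn_inj; rewrite -uk -{2}uE mdegD mdeg1 addn1.
move/mnm_lepP: um => um; apply/mnm_lepP => j; move: (um j).
by rewrite -uE expoD expoU uE mnmBE mnmDE; lia.
Qed.

(** Strictly above means that one of the variables can be divided out while
    staying above, which gives the inclusion from right to left. *)
Lemma mem_mxy_ideal_exp k :
  ideal_mul (@mxy K) (ideal_exp mon_ideal k) =i supported K (strictly_above k).
Proof.
move=> p; apply/idP/idP; move: p.
  apply: ideal_mul_min.
  + exact: supported0.
  + exact: supportedD.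
  + exact/supportedMl/strictly_above_shift.
  move=> x y xm; rewrite mem_ideal_exp; move: x y xm.
  suff sub1 : {subset @mxy K <= supported K (fun m => m != 0%MM)}.
    move=> x y /sub1 x1 yk; apply: supportedM x1 yk => m d m0 [w [wk wd]].
    exists w; split=> //; first by apply: lepm_trans wd _; apply: lem_addl.
    apply: contra_neq m0 => wmd; apply/mnmP => i; move/mnm_lepP/(_ i): wd.
    by rewrite wmd mnmDE mnm0E; lia.
  apply: ideal_gen_min.
  + exact: supported0.
  + exact: supportedD.
  + apply: supportedMl => m d m0.
    by apply: contra m0; rewrite mnmD_eq0 => /andP[].
  by move=> x; rewrite !inE => /orP[] /eqP->; apply/supportedX; rewrite mnm1_eq0.
apply: supported_min.
- exact: ideal_gen0.
- exact: ideal_genD.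
- exact: ideal_genM.
move=> m [u [uk um ne_um]].
have [j ltj] : exists j, (expo e u j < m j)%N.
  case: (pickP (fun j => expo e u j < m j)%N) => [j uj|nlt]; first by exists j.
  case/eqP: ne_um; apply: lem_anti => //; apply/mnm_lepP => j.
  by rewrite leqNgt nlt.
have /submK mE : (U_(j) <= m)%MM by rewrite lep1mP; lia.
rewrite -mE addmC mpolyXD mem_ideal_mul //.
  apply: mem_ideal_gen; rewrite !inE /vx /vy.
  by case: j {ltj mE} => [[|[|//]]] ltj; apply/orP; [left | right];
    apply/eqP; congr 'X_[U_(_)]; apply: val_inj.
rewrite mem_ideal_exp; apply/supportedX; exists u; split=> //.
move/mnm_lepP: um => um; apply/mnm_lepP => i; move: (um i).
by rewrite mnmBE mnm1E; case: eqP => [<-|_]; lia.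
Qed.

End MonomialIdeal.
Arguments mon_ideal K {n} e.

(** * The monomial basis of the fiber cone *)
Section FiberConeQuotient.
Local Open Scope ring_scope.
Variables (K : fieldType) (I : {pred {mpoly K[2]}}).
Implicit Types (p q : rees I).
Local Notation to := (@to_fiber_cone K I).

Lemma to_fiber_cone_surj (f : fiber_cone I) : exists p, f = to p.
Proof. by elim/quotW: f => p; exists p. Qed.

Lemma to_fiber_coneM p q : to (p * q) = to p * to q.
Proof. by rewrite /to_fiber_cone; exact: rmorphM. Qed.

Lemma to_fiber_coneD p q : to (p + q) = to p + to q.
Proof. by rewrite /to_fiber_cone; exact: raddfD. Qed.

Lemma to_fiber_cone0 : to 0 = 0.
Proof. by rewrite /to_fiber_cone; exact: raddf0. Qed.

Lemma to_fiber_cone1 : to 1 = 1.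
Proof. by rewrite /to_fiber_cone; exact: rmorph1. Qed.

End FiberConeQuotient.

Section FiberConeBasis.
Local Open Scope ring_scope.
Variables (K : fieldType) (n : nat) (e : 'I_n -> 'X_{1..2}) (T : pred 'X_{1..n}).
Implicit Types (u v w : 'X_{1..n}) (m d : 'X_{1..2}).
Local Notation I := (mon_ideal K e).
Local Notation to := (@to_fiber_cone K I).
Implicit Types (p q : rees I).

(** Together these say that T lists every minimal generator of every I^k exactly
    once: minimal generators are represented because each word is above a word
    in T, and words in T are minimal and distinct because they form an
    antichain. *)
Definition dominating :=
  forall u, exists w, [/\ T w, mdeg w = mdeg u & (expo e w <= expo e u)%MM].
Definition antichain :=
  forall w w', T w -> T w' -> mdeg w = mdeg w' -> (expo e w <= expo e w')%MM -> w = w'.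

Hypothesis (domT : dominating) (antiT : antichain).

(** The coordinate of the class of p on the basis element w, read on the
    representative p. *)
Definition ncoef p w : K := ((val p)`_(mdeg w))@_(expo e w).

Lemma rees_above p k m : (val p)`_k@_m != 0 -> above e k m.
Proof. by have := rees_coef p k; rewrite mem_ideal_exp => /asboolP; apply. Qed.

Lemma normal_below u w : T w -> mdeg u = mdeg w -> (expo e u <= expo e w)%MM ->
  expo e u = expo e w.
Proof.
move=> Tw uw le_uw; have [v [Tv vu le_vu]] := domT u.
have vw : v = w by apply: antiT => //; [rewrite vu | apply: lepm_trans le_uw].
by apply: lem_anti => //; rewrite -vw.
Qed.

(** A coordinate on T sits at a minimal monomial of I^k, so it vanishes on
    m I^k; conversely, a monomial of I^k that is not of the form [expo e w] with
    w in T lies strictly above such a one, hence in m I^k. *)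
Lemma fiber_cone_eqP p q :
  to p = to q <-> forall w, T w -> ncoef p w = ncoef q w.
Proof.
rewrite to_fiber_cone_eq; split=> [pq w Tw | pq k].
  apply/eqP; rewrite -subr_eq0 -mcoeffB; apply/negP => /negP nz.
  have := pq (mdeg w); rewrite mem_mxy_ideal_exp => /asboolP/(_ _ nz).
  by case=> u [uw le_uw]; rewrite (normal_below Tw uw le_uw) eqxx.
rewrite mem_mxy_ideal_exp; apply/asboolP => m nz.
have [u [uk le_um]] : above e k m.
  by rewrite -coefB in nz; apply: (@rees_above (p - q)); rewrite raddfB.
have [w [Tw wu le_wu]] := domT u.
exists w; split; [by rewrite wu | exact: lepm_trans le_um |].
apply: contra_neq nz => wm; have := pq w Tw; rewrite /ncoef wm wu uk mcoeffB => ->.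
by rewrite subrr.
Qed.

Lemma mono_subproof u : 'X_[expo e u] *: 'X^(mdeg u) \in @rees_pred {mpoly K[2]} I.
Proof.
apply/asboolP => k; rewrite coefZ coefXn; case: eqVneq => [->|_].
  by rewrite mulr1 mem_ideal_exp; apply/supportedX; exists u; rewrite lepm_refl.
by rewrite mulr0 ideal_exp0_mem.
Qed.
Definition mono u : rees I := Rees (mono_subproof u).

Lemma cst_subproof (c : K) : c%:MP%:P \in @rees_pred {mpoly K[2]} I.
Proof.
apply/asboolP => k; rewrite coefC; case: eqP => [->//|_].
exact: ideal_exp0_mem.
Qed.
Definition cst (c : K) : rees I := Rees (cst_subproof c).

Lemma ncoefD p q w : ncoef (p + q) w = ncoef p w + ncoef q w.
Proof. by rewrite /ncoef raddfD /= coefD mcoeffD. Qed.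

Lemma ncoef0 w : ncoef 0 w = 0.
Proof. by rewrite /ncoef raddf0 coef0 mcoeff0. Qed.

Lemma ncoefcM c p w : ncoef (cst c * p) w = c * ncoef p w.
Proof. by rewrite /ncoef rmorphM /= coefCM mcoeffCM. Qed.

(** The product of the basis element w' with the word u may be the basis element
    w only when w = w' + u as words.  This fails when a rewriting rule between
    words of equal exponents applies to w' + u. *)
Definition faithful_factor u := forall w w', T w -> T w' ->
  mdeg w = mdeg (w' + u)%MM -> expo e w = expo e (w' + u)%MM -> w = (w' + u)%MM.

(** If the coefficient at w of the product is nonzero, then w is above w' + u
    for some w' in T, hence equal in exponent because w is minimal, and so
    w = w' + u. *)
Lemma ncoef_monoM u p w : faithful_factor u -> T w ->
  ncoef (mono u * p) w = if (u <= w)%MM then ncoef p (w - u)%MM else 0.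
Proof.
move=> ffu Tw; rewrite /ncoef rmorphM /= -scalerAl coefZ coefXnM.
case: (boolP (u <= w)%MM) => [le_uw|/negP nle_uw].
  rewrite -(submK le_uw); move: (w - u)%MM => v.
  by rewrite mdegD ltnNge leq_addl addnK addmK expoD addmC mulrC mcoeffMX.
rewrite ltnNge; have [le_d|_] /= := leqP; last by rewrite mulr0 mcoeff0.
rewrite mulrC; apply/eqP/negP => /negP; rewrite -mcoeff_msupp => /msuppM_le.
case/allpairsP=> [[m1 m2] /= [m1p]]; rewrite msuppX mem_seq1 => /eqP-> wE.
move: m1p; rewrite mcoeff_msupp => /rees_above[u' [u'd le_u'm]].
have [w' [Tw' w'u' le_w'u']] := domT u'.
have dw : mdeg (w' + u)%MM = mdeg w by rewrite mdegD w'u' u'd subnK.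
have le_w'w : (expo e (w' + u) <= expo e w)%MM.
  rewrite wE expoD; apply/mnm_lepP => i; rewrite !mnmDE leq_add2r.
  by apply: (mnm_lepP (lepm_trans le_w'u' le_u'm)).
apply: nle_uw; rewrite (ffu w w') ?lem_addl //.
by apply/esym/normal_below.
Qed.

Lemma rees_with_coefs (eta : 'X_{1..n} -> K) N :
    (forall w, (N <= mdeg w)%N -> eta w = 0) ->
  exists p, forall w, T w -> ncoef p w = eta w.
Proof.
move=> etaN; pose F k : {mpoly K[2]} :=
  \sum_(v : 'X_{1..n < N} | T v && (mdeg v == k)) eta v *: 'X_[expo e v].
have Fsub : \poly_(k < N) F k \in @rees_pred {mpoly K[2]} I.
  apply/asboolP => k; rewrite coef_poly; case: ifP => _; last exact: ideal_exp0_mem.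
  apply: (big_ind (fun x => x \in ideal_exp I k)) => [|x y|v /andP[_ /eqP vk]].
  - exact: ideal_exp0_mem.
  - exact: ideal_expDr.
  rewrite -mul_mpolyC ideal_expMl // mem_ideal_exp.
  by apply/supportedX; exists (v : 'X_{1..n}); rewrite lepm_refl.
exists (Rees Fsub) => w Tw; rewrite /ncoef /= coef_poly.
have [ltw|lew] := ltnP; last by rewrite mcoeff0 etaN.
rewrite /F raddf_sum (bigD1 (Sub w ltw : 'X_{1..n < N})) /=; last by rewrite Tw eqxx.
rewrite mcoeffZ mcoeffX eqxx mulr1 big1 ?addr0 // => v /andP[/andP[Tv /eqP vw] ne_vw].
rewrite mcoeffZ mcoeffX; case: eqP => [vwE|]; last by rewrite mulr0.
case/eqP: ne_vw; apply: val_inj => /=; apply: antiT => //.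
by rewrite vwE lepm_refl.
Qed.

End FiberConeBasis.

(** * Algebraic dependence of three elements *)
Section AlgebraicDependence.
Local Open Scope ring_scope.
Variables (K : fieldType) (n : nat) (e : 'I_n -> 'X_{1..2}) (T : pred 'X_{1..n}).
Hypothesis (domT : dominating e T) (antiT : antichain e T).
Local Notation I := (mon_ideal K e).
Local Notation to := (@to_fiber_cone K I).
Implicit Types (p q : rees I) (w : 'X_{1..n}).

(** Exponents in the plane with the same first coordinate are comparable. This
    is what makes the degree k part of the fiber cone of dimension O(k). *)
Lemma antichain_ord0 w w' : T w -> T w' -> mdeg w = mdeg w' ->
  expo e w ord0 = expo e w' ord0 -> w = w'.
Proof.
move=> Tw Tw' ww' ex.
have le_or : (expo e w <= expo e w')%MM \/ (expo e w' <= expo e w)%MM.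
  by rewrite !lem2E ex leqnn /=; apply/orP; apply: leq_total.
by case: le_or => le; [| apply/esym]; apply: antiT.
Qed.

Lemma expo_ord0_bound : exists c, forall w, (expo e w ord0 <= c * mdeg w)%N.
Proof.
exists (\max_i e i ord0) => w; rewrite expoE mdegE big_distrr /=.
apply: leq_sum => i _; rewrite leq_mul2r; apply/orP; right.
exact: (leq_bigmax i).
Qed.

Lemma size_rees_exp p D i :
  (size (val p) <= D.+1)%N -> (size (val (p ^+ i)%R) <= (D * i).+1)%N.
Proof.
move=> pD; rewrite rmorphXn /=; apply: leq_trans (size_poly_exp_leq _ _) _.
by rewrite ltnS leq_mul2r; apply/orP; right; move: pD; case: (size _).
Qed.

Lemma size_rees_mul p q i j :
  (size (val p) <= i.+1)%N -> (size (val q) <= j.+1)%N ->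
  (size (val (p * q)%R) <= (i + j).+1)%N.
Proof.
move=> pi qj; rewrite rmorphM /=; apply: leq_trans (size_polyMleq _ _) _.
by move: pi qj; case: (size (val p)) => [|sp]; case: (size (val q)) => [|sq]; lia.
Qed.

Lemma ncoef_large p w : (size (val p) <= mdeg w)%N -> ncoef p w = 0.
Proof. by move=> le; rewrite /ncoef nth_default // mcoeff0. Qed.

(** The unknowns are the N^3 coefficients of a polynomial of degree less than N
    in each variable; the equations say that all coordinates of its value
    vanish.  A coordinate is located by its degree k < B and its x-degree, less
    than C, so there are at most B C = O(N^2) of them. *)
Lemma rees_dependent p0 p1 p2 : exists N (lam : nat -> nat -> nat -> K),
  (exists i j k, [/\ (i < N)%N, (j < N)%N, (k < N)%N & lam i j k != 0]) /\
  to (\sum_(i < N) \sum_(j < N) \sum_(k < N)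
        cst e (lam i j k) * (p2 ^+ k * p1 ^+ j * p0 ^+ i)) = 0.
Proof.
have [c cP] := expo_ord0_bound.
pose D := (size (val p0) + size (val p1) + size (val p2)).+1.
(* B <= 4 D N and C <= 4 (c + 1) D N, so B C <= N' N^2 < N^3. *)
pose N' := (16 * c.+1 * D * D)%N; pose N := N'.+1.
pose B := (3 * D * N).+1; pose C := (c * B).+1.
pose p (x : 'I_N * ('I_N * 'I_N)) := p2 ^+ x.2.2 * p1 ^+ x.2.1 * p0 ^+ x.1.
have pB x w : (B <= mdeg w)%N -> ncoef (p x) w = 0.
  move=> leBw; apply/ncoef_large/(leq_trans _ leBw).
  case: x => i [j k]; rewrite /p /=.
  apply: leq_trans (size_rees_mul (size_rees_mul _ _) _) _.
  - by apply: (size_rees_exp (D := D)); rewrite /D; lia.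
  - by apply: (size_rees_exp (D := D)); rewrite /D; lia.
  - by apply: (size_rees_exp (D := D)); rewrite /D; lia.
  have := ltn_ord i; have := ltn_ord j; have := ltn_ord k.
  by rewrite /B; nia.
(* The normal word with given degree and x-degree, if there is one. *)
pose wd (y : 'I_B * 'I_C) := [pick w : 'X_{1..n < B} |
  [&& T w, mdeg w == y.1 & expo e w ord0 == y.2]].
have [|lam [[[i [j k]] lam0] lamP]] := @exists_nontrivial_solution K
  ('I_N * ('I_N * 'I_N))%type ('I_B * 'I_C)%type
  (fun x y => if wd y is Some w then ncoef (p x) w else 0).
  rewrite !card_prod !card_ord /C /B.
  have leB : (B <= 4 * D * N)%N by rewrite /B /N /D; nia.
  have leC : (C <= 4 * c.+1 * D * N)%N by rewrite /C /B /N /D; nia.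
  apply: leq_ltn_trans (leq_mul leB leC) _.
  have -> : (4 * D * N * (4 * c.+1 * D * N) = N' * (N * N))%N by rewrite /N'; ring.
  by rewrite ltn_mul2r ltnSn muln_gt0.
exists N, (fun i j k => lam (inord i, (inord j, inord k))); split.
  by exists i, j, k; rewrite !ltn_ord !inord_val.
rewrite -(to_fiber_cone0 I); apply/(fiber_cone_eqP domT antiT) => w Tw.
rewrite ncoef0.
have -> : ncoef (\sum_(i < N) \sum_(j < N) \sum_(k < N)
    cst e (lam (inord i, (inord j, inord k))) * (p2 ^+ k * p1 ^+ j * p0 ^+ i)) w
    = \sum_x lam x * ncoef (p x) w.
  rewrite (eq_bigr (fun i : 'I_N => \sum_(x : 'I_N * 'I_N)
    cst e (lam (i, x)) * p (i, x))); last first.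
    move=> i' _; rewrite pair_bigA; apply: eq_bigr => -[j' k'] _.
    by rewrite !inord_val.
  rewrite pair_bigA /=.
  rewrite (@big_morph _ _ (fun q => ncoef q w) _ _ _ _ (fun p q => ncoefD p q w) (@ncoef0 K n e w)).
  by apply: eq_bigr => -[i' x'] _; rewrite ncoefcM.
have [leBw|ltwB] := leqP B (mdeg w).
  by rewrite big1 // => x _; rewrite pB ?mulr0.
have ltC : (expo e w ord0 < C)%N.
  by rewrite /C ltnS; apply: leq_trans (cP w) _; rewrite leq_mul2l ltnW ?orbT.
have := lamP (Ordinal ltwB, Ordinal ltC); rewrite /wd; case: pickP => [v|no].
  case/and3P=> Tv /eqP vw /eqP v0; suff -> : (v : 'X_{1..n}) = w by [].
  exact: antichain_ord0.
by have := no (Sub w ltwB : 'X_{1..n < B}); rewrite /= Tw !eqxx.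
Qed.

(** Applying the factorization at the lowest term once per variable. *)
Lemma fiber_cone_iterated_boundary (s : seq (fiber_cone I)) :
  size s = 3 -> iterated_boundary s 0.
Proof.
case: s => [|x0 [|x1 [|x2 [|//]]]] // _.
have [p0 ->] := to_fiber_cone_surj x0; have [p1 ->] := to_fiber_cone_surj x1.
have [p2 ->] := to_fiber_cone_surj x2.
have [N [lam [[i [j [k [ltiN ltjN ltkN lam0]]]] lamP]]] := rees_dependent p0 p1 p2.
have toX p i' : to (p ^+ i') = to p ^+ i'.
  by elim: i' => [|i' IH]; rewrite ?to_fiber_cone1 // !exprS to_fiber_coneM IH.
have toE := big_morph to (@to_fiber_coneD K I) (@to_fiber_cone0 K I).
pose phi2 i j := \sum_(k < N) to (cst e (lam i j k)) * to p2 ^+ k.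
pose phi1 i := \sum_(j < N) phi2 i j * to p1 ^+ j.
have sumE : \sum_(i < N) phi1 i * to p0 ^+ i = 0.
  rewrite -[RHS]lamP toE.
  apply: eq_bigr => i' _; rewrite toE mulr_suml.
  apply: eq_bigr => j' _; rewrite toE -mulrA mulr_suml.
  by apply: eq_bigr => k' _; rewrite !to_fiber_coneM !toX !mulrA.
have step2 i' j' : ((forall k, (k < N)%N -> lam i' j' k = 0) /\ phi2 i' j' = 0) \/
    iterated_boundary [:: to p2] (phi2 i' j').
  apply: (@iterated_boundary_sum _ (fun k => lam i' j' k = 0) (to p2) [::]
    (fun k => to (cst e (lam i' j' k))) N) => k' _.
  have [->|nz] := eqVneq (lam i' j' k') 0; [left; split=> // | right].
    rewrite -(to_fiber_cone0 I); congr to; apply: val_inj.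
    by rewrite raddf0 /= mpolyC0 polyC0.
  exists (to (cst e (lam i' j' k')^-1)); rewrite -to_fiber_coneM -(to_fiber_cone1 I).
  congr to; apply: val_inj; rewrite rmorph1 rmorphM /= -polyCM -mpolyCM mulVf //.
have step1 i' : ((forall j k, (j < N)%N -> (k < N)%N -> lam i' j k = 0) /\ phi1 i' = 0) \/
    iterated_boundary [:: to p1; to p2] (phi1 i').
  have [|[lam00 sum0]|] := @iterated_boundary_sum _ (fun j => forall k, (k < N)%N -> lam i' j k = 0)
    (to p1) [:: to p2] (phi2 i') N; [by move=> j' _; apply: step2 | | by right].
  by left; split=> // j' k' ltj ltk; apply: lam00.
have [|[lam00 sum0]|] := @iterated_boundary_sum _
  (fun i => forall j k, (j < N)%N -> (k < N)%N -> lam i j k = 0)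
  (to p0) [:: to p1; to p2] phi1 N; [by move=> i' _; apply: step1 | | by rewrite sumE].
by case/eqP: lam0; apply: lam00.
Qed.

End AlgebraicDependence.

(** * Primes attached to faces of the Newton polygon *)
Section WeightPart.
Local Open Scope ring_scope.
Variables (K : fieldType) (r s : nat).
Local Notation S := {mpoly K[2]}.
Implicit Types (m : 'X_{1..2}) (p q : S) (d : nat).

Definition weight m : nat := r * m ord0 + s * m ord_max.

Lemma weightD m m' : weight (m + m')%MM = (weight m + weight m')%N.
Proof. by rewrite /weight !mnmDE; lia. Qed.

Lemma weight_le m m' : (m <= m')%MM -> (weight m <= weight m')%N.
Proof. by move=> /submK <-; rewrite weightD leq_addl. Qed.

Lemma weight_lt m m' : (0 < r)%N -> (0 < s)%N ->
  (m <= m')%MM -> m != m' -> (weight m < weight m')%N.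
Proof.
move=> r0 s0 le_mm' ne_mm'; rewrite ltn_neqAle weight_le // andbT.
apply: contra_neq ne_mm' => eq_w; apply: lem_anti => //.
move: le_mm' eq_w; rewrite !lem2E /weight => /andP[le0 le1] eq_w.
have := leq_mul (leqnn r) le0; have := leq_mul (leqnn s) le1 => le_s le_r.
by apply/andP; split; [rewrite -(leq_pmul2l r0) | rewrite -(leq_pmul2l s0)]; lia.
Qed.

Definition weight_part d p : S := \sum_(m <- msupp p | weight m == d) p@_m *: 'X_[m].

Lemma mcoeff_weight_part d p m :
  (weight_part d p)@_m = if weight m == d then p@_m else 0.
Proof.
have [mp|mp] := boolP (m \in msupp p); last first.
  rewrite (memN_msupp_eq0 mp) if_same /weight_part raddf_sum big_seq_cond big1 //= => k /andP[kp _].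
  by rewrite mcoeffZ mcoeffX; case: eqP mp => [<-|]; rewrite ?kp ?mulr0.
rewrite /weight_part raddf_sum big_mkcond (bigD1_seq m) //= mcoeffZ mcoeffX eqxx mulr1.
rewrite big1 ?addr0 // => k km; case: ifP => // _.
by rewrite mcoeffZ mcoeffX (negPf km) mulr0.
Qed.

Lemma weight_partD d p q : weight_part d (p + q) = weight_part d p + weight_part d q.
Proof.
apply/mpolyP => m; rewrite mcoeffD !mcoeff_weight_part.
by case: ifP => _; rewrite ?mcoeffD ?addr0.
Qed.

Lemma weight_part0 d : weight_part d 0 = 0.
Proof. by rewrite /weight_part msupp0 big_nil. Qed.

(** Parts of lowest weight multiply, because all other products of terms have
    larger weight. *)
Lemma weight_partM d d' p q :
  p \in supported K (fun m => (d <= weight m)%N) ->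
  q \in supported K (fun m => (d' <= weight m)%N) ->
  weight_part (d + d') (p * q) = weight_part d p * weight_part d' q.
Proof.
have part_supp c f : weight_part c f \in supported K (fun m => weight m = c).
  apply/asboolP => m; rewrite mcoeff_weight_part.
  by case: (weight m =P c); rewrite ?eqxx.
have rest_supp c f : f \in supported K (fun m => (c <= weight m)%N) ->
    f - weight_part c f \in supported K (fun m => (c < weight m)%N).
  move=> /asboolP fc; apply/asboolP => m; rewrite mcoeffB mcoeff_weight_part.
  case: (weight m =P c) => [_|ne]; rewrite ?subrr ?eqxx // subr0 => /fc; lia.
move=> pd qd'; apply/mpolyP => m; rewrite mcoeff_weight_part.
set P := weight_part d p; set Q := weight_part d' q.
have pqE : p * q = P * Q + ((p - P) * q + P * (q - Q)) by ring.
have /asboolP PQ : P * Q \in supported K (fun m => weight m = (d + d')%N).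
  apply: supportedM (part_supp d p) (part_supp d' q) => m1 m2.
  by rewrite weightD => -> ->.
have rest : (p - P) * q + P * (q - Q) \in supported K (fun m => (d + d' < weight m)%N).
  apply: supportedD; [apply: supportedM (rest_supp _ _ pd) qd'
                     | apply: supportedM (part_supp _ _) (rest_supp _ _ qd')];
    by move=> m1 m2; rewrite weightD; lia.
case: eqP => [wm|ne]; last first.
  by apply/esym/eqP; apply: contra_notT ne; apply: PQ.
rewrite pqE mcoeffD; have [->|nz] := eqVneq ((p - P) * q + P * (q - Q))@_m 0.
  by rewrite addr0.
by move/asboolP: rest => /(_ m nz); rewrite wm ltnn.
Qed.

End WeightPart.

Section FacePrimes.
Local Open Scope ring_scope.
Variables (K : fieldType) (n : nat) (e : 'I_n -> 'X_{1..2}).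
Local Notation I := (mon_ideal K e).
Local Notation to := (@to_fiber_cone K I).
Implicit Types (p q : rees I) (u : 'X_{1..n}) (m : 'X_{1..2}).

Lemma weight_expo r s u :
  weight r s (expo e u) = (\sum_i weight r s (e i) * u i)%N.
Proof.
rewrite /weight !expoE !big_distrr -big_split; apply: eq_bigr => i _ /=; lia.
Qed.

(** The line r i + s j = E supports the Newton polygon of I, and r, s are
    positive so that it touches it along a compact face. *)
Definition supports r s E :=
  [/\ (0 < r)%N, (0 < s)%N & forall i, (E <= weight r s (e i))%N].

Lemma weight_above r s E k m :
  supports r s E -> above e k m -> (E * k <= weight r s m)%N.
Proof.
case=> _ _ Ee [u [<- /(weight_le r s)]]; apply: leq_trans.
rewrite weight_expo mdegE big_distrr /=; apply: leq_sum => i _.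
by rewrite leq_mul2r Ee orbT.
Qed.

Lemma weight_strictly_above r s E k m :
  supports r s E -> strictly_above e k m -> (E * k < weight r s m)%N.
Proof.
move=> sE [u [uk le_um ne_um]]; have [r0 s0 _] := sE.
apply: leq_ltn_trans (weight_lt r0 s0 le_um ne_um).
by apply: (weight_above sE); exists u; rewrite lepm_refl.
Qed.

(** Since I^k has weights at least E k, this is the part of lowest weight for
    the grading of the Rees algebra in which t has weight -E. *)
Definition initial_form r s E p : {poly {mpoly K[2]}} :=
  \poly_(k < size (val p)) weight_part r s (E * k) (val p)`_k.

Lemma coef_initial_form r s E p k :
  (initial_form r s E p)`_k = weight_part r s (E * k) (val p)`_k.
Proof.
by rewrite coef_poly; case: ltnP => // le; rewrite nth_default // weight_part0.
Qed.

Definition face_prime r s E : {pred fiber_cone I} :=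
  [pred f | `[< exists2 p, f = to p & initial_form r s E p = 0 >]].

Section Prime.
Variables (r s E : nat).
Hypothesis sE : supports r s E.

Lemma initial_formD p q :
  initial_form r s E (p + q) = initial_form r s E p + initial_form r s E q.
Proof.
by apply/polyP => k; rewrite coefD !coef_initial_form raddfD /= coefD weight_partD.
Qed.

Lemma initial_formM p q :
  initial_form r s E (p * q) = initial_form r s E p * initial_form r s E q.
Proof.
have Ep (f : rees I) k : (val f)`_k \in supported K (fun m => (E * k <= weight r s m)%N).
  apply/asboolP => m nz; apply: (weight_above sE); move: nz.
  exact: rees_above.
apply/polyP => k; rewrite coefM !coef_initial_form rmorphM /= coefM.
rewrite (big_morph _ (@weight_partD K r s (E * k)) (@weight_part0 K r s (E * k))).
apply: eq_bigr => i _; rewrite !coef_initial_form -weight_partM //.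
by rewrite -mulnDr subnKC // -ltnS.
Qed.

(** Monomials of m I^k have weight larger than E k, so the initial form is
    defined on the fiber cone. *)
Lemma initial_form_eq p q : to p = to q -> initial_form r s E p = initial_form r s E q.
Proof.
move/to_fiber_cone_eq => pq; apply/polyP => k; rewrite !coef_initial_form.
apply/mpolyP => m; rewrite !mcoeff_weight_part; case: eqP => // wm.
apply/eqP; rewrite -subr_eq0 -mcoeffB; apply/negP => /negP nz.
have := pq k; rewrite mem_mxy_ideal_exp => /asboolP/(_ m nz).
by move/(weight_strictly_above sE); rewrite wm ltnn.
Qed.

Lemma mem_face_prime p : (to p \in face_prime r s E) <-> initial_form r s E p = 0.
Proof.
split=> [/asboolP[q pq q0] | p0]; last by apply/asboolP; exists p.
by rewrite (initial_form_eq pq).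
Qed.

Lemma face_primeP : prime_ideal (face_prime r s E).
Proof.
have L0 : initial_form r s E 0 = 0.
  by apply/polyP => k; rewrite coef_initial_form raddf0 !coef0 weight_part0.
have L1_coef : ((initial_form r s E 1)`_0)@_0%MM = 1.
  rewrite coef_initial_form mcoeff_weight_part /weight !mnm0E !muln0 eqxx.
  by rewrite (_ : val 1 = 1) // coef1 mcoeff1 eqxx.
split; first split.
- by rewrite -(to_fiber_cone0 I); apply/mem_face_prime.
- apply/negP; rewrite -(to_fiber_cone1 I) => /mem_face_prime L1.
  have := oner_neq0 K; rewrite -L1_coef L1 coef0 mcoeff0 eqxx //.
- move=> a u v; have [pa ->] := to_fiber_cone_surj a.
  have [p ->] := to_fiber_cone_surj u; have [q ->] := to_fiber_cone_surj v.
  move=> /mem_face_prime p0 /mem_face_prime q0; rewrite -to_fiber_coneM -to_fiber_coneD.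
  by apply/mem_face_prime; rewrite initial_formD initial_formM p0 q0 mulr0 addr0.
move=> u v; have [p ->] := to_fiber_cone_surj u; have [q ->] := to_fiber_cone_surj v.
rewrite -to_fiber_coneM => /mem_face_prime/eqP; rewrite initial_formM mulf_eq0.
by case/orP=> /eqP f0; apply/orP; [left | right]; apply/mem_face_prime.
Qed.

Lemma mono_face_prime i :
  (to (mono K e U_(i)%MM) \in face_prime r s E) = (weight r s (e i) != E).
Proof.
apply/idP/idP => [/mem_face_prime L0|ne].
  apply/eqP => wE; move/polyP/(_ 1%N)/mpolyP/(_ (e i))/eqP: L0.
  rewrite coef_initial_form mcoeff_weight_part muln1 wE eqxx coef0 mcoeff0 /=.
  by rewrite mdeg1 expoU coefZ coefXn eqxx mulr1 mcoeffX eqxx oner_eq0.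
apply/mem_face_prime/polyP => k; apply/mpolyP => m; rewrite coef_initial_form.
rewrite mcoeff_weight_part coef0 mcoeff0 /= mdeg1 expoU coefZ coefXn.
case: eqP => // wm; case: eqP => [k1|_]; last by rewrite mulr0 mcoeff0.
rewrite mulr1 mcoeffX; case: eqP => // eim; case/eqP: ne.
by rewrite eim wm k1 muln1.
Qed.

End Prime.

(** A smaller face gives a larger prime.  A monomial of I^k on the face of
    (r', s') is a product of k generators on it, and these are on the face of
    (r, s). *)
Lemma face_prime_sub r s E r' s' E' :
    supports r s E -> supports r' s' E' ->
    (forall i, weight r' s' (e i) = E' -> weight r s (e i) = E) ->
  {subset face_prime r s E <= face_prime r' s' E'}.
Proof.
move=> sE sE' sub f; have [p ->] := to_fiber_cone_surj f.
move=> /(mem_face_prime sE) p0; apply/(mem_face_prime sE')/polyP => k.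
rewrite coef_initial_form coef0; apply/mpolyP => m; rewrite mcoeff_weight_part mcoeff0.
case: eqP => // wm; apply/eqP/negP => /negP nz.
have [u [uk le_um]] := rees_above nz.
have um : expo e u = m.
  apply/eqP/negP => /negP ne.
  have : strictly_above e k m by exists u.
  by move/(weight_strictly_above sE'); rewrite wm ltnn.
have face i : u i != 0%N -> weight r' s' (e i) = E'.
  move=> ui; have [_ _ Ee'] := sE'.
  have : (\sum_j weight r' s' (e j) * u j = \sum_j E' * u j)%N.
    by rewrite -weight_expo um wm -uk mdegE big_distrr.
  rewrite (bigD1 i) //= [RHS](bigD1 i) //=.
  have : (\sum_(j | j != i) E' * u j <= \sum_(j | j != i) weight r' s' (e j) * u j)%N.
    by apply: leq_sum => j _; rewrite leq_mul2r Ee' orbT.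
  move=> le_rest eq_sum; apply/eqP; rewrite eqn_leq Ee' andbT.
  rewrite -(leq_pmul2r (m := u i)) ?lt0n //.
  by rewrite -(leq_add2r (\sum_(j | j != i) weight r' s' (e j) * u j)) eq_sum leq_add2l.
have wm' : weight r s m = (E * k)%N.
  rewrite -um weight_expo -uk mdegE big_distrr; apply: eq_bigr => i _ /=.
  by have [->|ui] := eqVneq (u i) 0%N; [rewrite !muln0 | rewrite (sub i (face i ui))].
move/polyP/(_ k)/mpolyP/(_ m): p0.
by rewrite coef_initial_form mcoeff_weight_part wm' eqxx coef0 mcoeff0 => pm; rewrite pm eqxx in nz.
Qed.

End FacePrimes.

(** * Regular sequences of length two *)
Section RegularPair.
Local Open Scope ring_scope.
Variable A : comNzRingType.
Implicit Types (x y f g h : A).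

(** Regularity of the sequence x, y without the requirement that it generate a
    proper ideal. *)
Definition regular_pair x y :=
  (forall f, f * x = 0 -> f = 0) /\
  (forall f g, f * y = g * x -> exists h, f = h * x).

Lemma ideal_gen_nil f : f \in ideal_gen (mem [::]) -> f = 0.
Proof.
move=> f0; apply/eqP; move: f f0.
apply: (@ideal_gen_min A (mem [::]) (pred1 0)) => //= [|f g|a f]; rewrite ?inE ?eqxx //.
  by move=> /eqP-> /eqP->; rewrite addr0.
by move=> /eqP->; rewrite mulr0.
Qed.

Lemma ideal_gen_seq1 x f : f \in ideal_gen (mem [:: x]) <-> exists g, f = g * x.
Proof.
split=> [fx|[g ->]]; last by rewrite ideal_genM ?mem_ideal_gen ?inE.
suff : f \in [pred f | `[< exists g, f = g * x >]] by move/asboolP.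
move: f fx; apply: ideal_gen_min.
- by apply/asboolP; exists 0; rewrite mul0r.
- move=> _ _ /asboolP[g ->] /asboolP[h ->]; apply/asboolP.
  by exists (g + h); rewrite mulrDl.
- by move=> a _ /asboolP[g ->]; apply/asboolP; exists (a * g); rewrite mulrA.
by move=> y; rewrite inE => /eqP ->; apply/asboolP; exists 1; rewrite mul1r.
Qed.

Lemma regular_sequence_pair x y (P : {pred A}) :
  regular_pair x y -> prime_ideal P -> x \in P -> y \in P ->
  regular_sequence [:: x; y].
Proof.
move=> [regx regy] [[P0 P1 PD] _] Px Py; split.
  move=> [|[|//]] _ f /=.
    by move=> /ideal_gen_nil/regx ->; apply: ideal_gen0.
  by move=> /ideal_gen_seq1[g /regy fx]; apply/ideal_gen_seq1.
apply: contra P1; move: (1 : A); apply: ideal_gen_min => //.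
- by move=> f g Pf Pg; rewrite -[f]mul1r; apply: PD.
- by move=> a f Pf; rewrite -[_ * _]addr0; apply: PD.
by move=> f; rewrite !inE => /orP[] /eqP ->.
Qed.

End RegularPair.

Section MonomialRegularPairs.
Local Open Scope ring_scope.
Variables (K : fieldType) (n : nat) (e : 'I_n -> 'X_{1..2}) (T : pred 'X_{1..n}).
Hypothesis (domT : dominating e T) (antiT : antichain e T).
Local Notation I := (mon_ideal K e).
Local Notation to := (@to_fiber_cone K I).
Local Notation mono := (mono K e).
Implicit Types (p q h : rees I) (u v w : 'X_{1..n}).

(** The words u and v share no letter, in the form in which this is used. *)
Definition independent u v := forall w, (u <= w + v)%MM = (u <= w)%MM.

Lemma faithful_factor_closed u :
  (forall w, T w -> T (w + u)%MM) -> faithful_factor e T u.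
Proof. by move=> Tu w w' Tw Tw' d E; apply: antiT => //; rewrite ?E ?lepm_refl; auto. Qed.

Lemma to_fiber_cone_eq0 p : to p = 0 -> forall w, T w -> ncoef p w = 0.
Proof.
rewrite -(to_fiber_cone0 I) => /(fiber_cone_eqP domT antiT) p0 w Tw.
by rewrite p0 // ncoef0.
Qed.

(** The quotients needed for regularity are obtained by prescribing their
    coordinates as shifted coordinates of p; finitely many are nonzero because
    the shift does not lower degrees. *)
Lemma shift_coefs p (s : 'X_{1..n} -> 'X_{1..n}) :
  (forall w, (mdeg w <= mdeg (s w))%N) ->
  exists h, forall w, T w -> ncoef h w = ncoef p (s w).
Proof.
move=> les; apply: (rees_with_coefs (N := size (val p)) antiT) => w lew.
by apply/ncoef_large/(leq_trans lew).
Qed.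

(** Adding u, or v, maps normal words bijectively onto the normal words that
    contain it.  Hence p is a multiple of u exactly when its coordinates at the
    normal words not containing u vanish; multiplying by v does not change
    whether a word contains u. *)
Lemma free_regular_pair u v :
    (forall w, T (w + u)%MM = T w) -> (forall w, T (w + v)%MM = T w) ->
    independent u v ->
  regular_pair (to (mono u)) (to (mono v)).
Proof.
move=> Tu Tv uv.
have ffu : faithful_factor e T u by apply: faithful_factor_closed => w; rewrite Tu.
have ffv : faithful_factor e T v by apply: faithful_factor_closed => w; rewrite Tv.
have cu p w : T w -> ncoef (mono u * p) (w + u)%MM = ncoef p w.
  by move=> Tw; rewrite (ncoef_monoM domT antiT) ?Tu // lem_addl addmK.
have cv p w : T w -> ncoef (mono v * p) (w + v)%MM = ncoef p w.
  by move=> Tw; rewrite (ncoef_monoM domT antiT) ?Tv // lem_addl addmK.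
split=> [f|f g]; have [p ->] := to_fiber_cone_surj f.
  rewrite -to_fiber_coneM mulrC => /to_fiber_cone_eq0 p0.
  rewrite -(to_fiber_cone0 I); apply/(fiber_cone_eqP domT antiT) => w Tw.
  by rewrite ncoef0 -cu // p0 ?Tu.
have [q ->] := to_fiber_cone_surj g; rewrite -!to_fiber_coneM.
rewrite [p * _]mulrC [q * _]mulrC => /(fiber_cone_eqP domT antiT) pq.
have [|h hP] := @shift_coefs p (fun w => (w + u)%MM).
  by move=> w; rewrite mdegD leq_addr.
exists (to h); rewrite -to_fiber_coneM mulrC; apply/(fiber_cone_eqP domT antiT) => w Tw.
rewrite (ncoef_monoM domT antiT) //; case: ifP => [le_uw|nle_uw].
  by rewrite hP ?submK // -Tu submK.
by rewrite -cv // pq ?Tv // (ncoef_monoM domT antiT) ?Tv // uv nle_uw.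
Qed.

(** The hypotheses describe u u' = v v' = u v = 0 on normal words, with no other
    obstruction to multiplying by these words.  A normal word without u can be
    multiplied by u', one with u can be multiplied by u, and similarly for v,
    v'. *)
Section Binomial.
Variables (u u' v v' : 'X_{1..n}).
Hypothesis ff : forall w, faithful_factor e T w.
Hypothesis T_down : forall w w', T (w + w')%MM -> T w.
Hypothesis Tu' : forall w, T w -> ~~ (u <= w)%MM -> T (w + u')%MM.
Hypothesis Tu : forall w, T w -> (u <= w)%MM -> T (w + u)%MM.
Hypothesis uu' : independent u u'.
Hypothesis u_u' : forall w, T w -> (u <= w)%MM -> ~~ (u' <= w)%MM.
Hypothesis Tv' : forall w, T w -> ~~ (v <= w)%MM -> T (w + v')%MM.
Hypothesis Tv : forall w, T w -> (v <= w)%MM -> T (w + v)%MM.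
Hypothesis vv' : independent v v'.
Hypothesis v_v' : forall w, T w -> (v <= w)%MM -> ~~ (v' <= w)%MM.
Hypothesis u_v : forall w, T w -> (u <= w)%MM -> ~~ (v <= w)%MM.
Hypothesis uv : independent u v.
Hypothesis uv' : independent u v'.
Hypothesis u'v : independent u' v.
Hypothesis u'v' : independent u' v'.
Hypothesis vu' : independent v u'.

Lemma ncoef_binomial x y p w : T w ->
  ncoef ((mono x + mono y) * p) w =
    (if (x <= w)%MM then ncoef p (w - x)%MM else 0) +
    (if (y <= w)%MM then ncoef p (w - y)%MM else 0).
Proof. by move=> Tw; rewrite mulrDl ncoefD !(ncoef_monoM domT antiT). Qed.

(** At most one of u, u' divides a normal word, so each coordinate of
    (u + u') p is a coordinate of p.  Every coordinate of p occurs, which makes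
    u + u' regular.  The multiples of u + u' are the p whose coordinates vanish
    at the words containing neither u nor u' ([p0]) and agree at w + u and
    w + u' when both are normal and w does not contain u ([puu']).  Both
    conditions can be read on (v + v') p at one further letter v or v'. *)
Lemma binomial_regular_pair :
  regular_pair (to (mono u + mono u')) (to (mono v + mono v')).
Proof.
split=> [f|f g]; have [p ->] := to_fiber_cone_surj f.
  rewrite -to_fiber_coneM mulrC => /to_fiber_cone_eq0 p0.
  rewrite -(to_fiber_cone0 I); apply/(fiber_cone_eqP domT antiT) => w Tw.
  rewrite ncoef0; have [le_uw|nle_uw] := boolP (u <= w)%MM.
    have Twu := Tu Tw le_uw; have := p0 _ Twu.
    by rewrite ncoef_binomial // lem_addl addmK (negPf (u_u' Twu (lem_addl _ _))) addr0.
  have Twu' := Tu' Tw nle_uw; have := p0 _ Twu'.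
  by rewrite ncoef_binomial // lem_addl addmK uu' (negPf nle_uw) add0r.
have [q ->] := to_fiber_cone_surj g; rewrite -!to_fiber_coneM.
rewrite [p * _]mulrC [q * _]mulrC => /(fiber_cone_eqP domT antiT) pq.
have p0 w : T w -> ~~ (u <= w)%MM -> ~~ (u' <= w)%MM -> ncoef p w = 0.
  move=> Tw nle_uw nle_u'w; have [le_vw|nle_vw] := boolP (v <= w)%MM.
    have Twv := Tv Tw le_vw; have := pq _ Twv.
    rewrite !ncoef_binomial // lem_addl addmK (negPf (v_v' Twv (lem_addl _ _))).
    by rewrite uv u'v (negPf nle_uw) (negPf nle_u'w) !addr0.
  have Twv' := Tv' Tw nle_vw; have := pq _ Twv'.
  rewrite !ncoef_binomial // lem_addl addmK vv' (negPf nle_vw).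
  by rewrite uv' u'v' (negPf nle_uw) (negPf nle_u'w) add0r addr0.
have puu' w : T (w + u)%MM -> ~~ (u <= w)%MM -> ncoef p (w + u')%MM = ncoef p (w + u)%MM.
  move=> Twu nle_uw; have Tw := T_down Twu; have Twu' := Tu' Tw nle_uw.
  have nle_vwu := u_v Twu (lem_addl _ _).
  have nle_vw : ~~ (v <= w)%MM.
    by apply: contra nle_vwu => le_vw; apply: lepm_trans le_vw (lem_addr _ _).
  have Twuv' := Tv' Twu nle_vwu.
  have Twu'v' : T (w + u' + v')%MM by apply: Tv' => //; rewrite vu'.
  have E1 := pq _ Twu'v'; have E2 := pq _ Twuv'.
  have addC x : (w + x + v' - x)%MM = (w + v')%MM.
    by rewrite -addmA [(x + _)%MM]addmC addmA addmK.
  move: E1; rewrite !ncoef_binomial // lem_addl addmK !vv' vu' (negPf nle_vw) uv' uu'.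
  rewrite (negPf nle_uw) !add0r u'v' lem_addl addC => ->.
  move: E2; rewrite !ncoef_binomial // lem_addl addmK vv' (negPf nle_vwu) uv' lem_addl.
  by rewrite addC u'v' (negPf (u_u' Twu (lem_addl _ _))) addr0 add0r => ->.
have [|h hP] := @shift_coefs p
    (fun w => if (u <= w)%MM then (w + u)%MM else (w + u')%MM).
  by move=> w; case: ifP => _; rewrite mdegD leq_addr.
exists (to h); rewrite -to_fiber_coneM mulrC; apply/(fiber_cone_eqP domT antiT) => w Tw.
rewrite ncoef_binomial //; have [le_uw|nle_uw] := boolP (u <= w)%MM.
  rewrite (negPf (u_u' Tw le_uw)) addr0; move: Tw; rewrite -(submK le_uw).
  move: (w - u)%MM => {le_uw}w Twu; rewrite addmK hP; last exact: T_down Twu.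
  by case: ifP => // /negP/negP nle; rewrite puu'.
rewrite add0r; have [le_u'w|nle_u'w] := boolP (u' <= w)%MM; last exact: p0.
move: Tw nle_uw; rewrite -(submK le_u'w) uu'; move: (w - u')%MM => {le_u'w}w Twu' nle_uw.
by rewrite addmK hP ?(negPf nle_uw) //; apply: T_down Twu'.
Qed.

End Binomial.

End MonomialRegularPairs.

(** * A Cohen-Macaulay criterion *)
Section Criterion.
Local Open Scope ring_scope.
Variables (K : fieldType) (n : nat) (e : 'I_n -> 'X_{1..2}) (T : pred 'X_{1..n}).
Hypothesis (domT : dominating e T) (antiT : antichain e T).
Hypothesis e1 : supports e 1 1 1.
Local Notation I := (mon_ideal K e).
Local Notation to := (@to_fiber_cone K I).
Implicit Types (p : rees I) (u : 'X_{1..n}).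

Lemma supports_zero : supports e 1 1 0.
Proof. by []. Qed.

Lemma mono_fiber_cone_plus u : (0 < mdeg u)%N -> to (mono K e u) \in fiber_cone_plus I.
Proof.
move=> u0; apply/asboolP; exists (mono K e u) => //=.
by rewrite coefZ coefXn; case: eqP u0 => [<-|_] //; rewrite mulr0.
Qed.

Lemma fiber_cone_plusD : {in fiber_cone_plus I &, forall x y, x + y \in fiber_cone_plus I}.
Proof.
move=> _ _ /asboolP[p p0 ->] /asboolP[q q0 ->]; apply/asboolP; exists (p + q).
  by rewrite raddfD /= coefD p0 q0 addr0.
by rewrite to_fiber_coneD.
Qed.

(** The weight (1, 1) with bound 0 sees only constants in degree 0, so its prime
    contains the irrelevant ideal; it is the top of the chain and certifies that
    regular pairs generate proper ideals. *)
Lemma fiber_cone_plus_sub : {subset fiber_cone_plus I <= @face_prime K n e 1 1 0}.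
Proof.
move=> _ /asboolP[p p0 ->]; apply/(mem_face_prime supports_zero)/polyP => k.
rewrite coef_initial_form coef0 mul0n; apply/mpolyP => m.
rewrite mcoeff_weight_part mcoeff0; case: eqP => // wm; apply/eqP/negP => /negP nz.
have := weight_above e1 (rees_above nz); rewrite wm.
by case: k nz => [|//]; rewrite p0 mcoeff0 eqxx.
Qed.

Lemma fiber_cone_cohen_macaulay x y r s E r' s' E' i i' :
    x \in fiber_cone_plus I -> y \in fiber_cone_plus I -> regular_pair x y ->
    supports e r s E -> supports e r' s' E' ->
    (forall j, weight r' s' (e j) = E' -> weight r s (e j) = E) ->
    weight r s (e i) = E -> weight r' s' (e i) != E' -> weight r' s' (e i') = E' ->
  graded_cohen_macaulay (fiber_cone_plus I).
Proof.
move=> xP yP xy sE sE' sub wi w'i w'i'.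
have bd := fiber_cone_iterated_boundary (K := K) domT antiT.
exists 2; split; split.
- exists [:: x; y]; split=> //; first by move=> z; rewrite !inE => /orP[] /eqP ->.
  by apply: regular_sequence_pair xy (face_primeP K supports_zero) _ _;
    apply: fiber_cone_plus_sub.
- by move=> z _; apply: regular_sequence_bound.
- exists (fun k => nth (@face_prime K n e 1 1 0) [:: @face_prime K n e r s E; @face_prime K n e r' s' E'] k).
  split=> [[|[|[|//]]] _|[|[|//]] _] /=; [exact: face_primeP.. | |].
    split; first exact: face_prime_sub.
    by exists (to (mono K e U_(i)%MM)); rewrite mono_face_prime // wi eqxx.
  split.
    apply: (face_prime_sub sE' supports_zero) => j wj.
    by have [_ _ /(_ j)] := e1; rewrite wj.
  exists (to (mono K e U_(i')%MM)); rewrite mono_face_prime // ?w'i' ?eqxx //.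
  by have [_ _ /(_ i')] := e1; rewrite lt0n.
- exact: krull_dim_bound.
Qed.

End Criterion.

(** * Normal forms by rewriting *)
Section StandardWords.
Variables (n : nat) (e : 'I_n -> 'X_{1..2}).
Implicit Types (u w : 'X_{1..n}) (rules : seq ('X_{1..n} * 'X_{1..n})).

(** The words to which no rule applies; a rule replaces its first component by
    its second. *)
Definition standard rules w := all (fun r => ~~ (r.1 <= w)%MM) rules.

Definition lowering (mu : 'X_{1..n} -> nat) rules := forall r, r \in rules ->
  [/\ mdeg r.2 = mdeg r.1, (expo e r.2 <= expo e r.1)%MM & mu r.2 < mu r.1].

Lemma standard_down rules w u : standard rules (w + u)%MM -> standard rules w.
Proof.
apply: sub_all => r; apply: contra => le_rw.
exact: lepm_trans le_rw (lem_addr _ _).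
Qed.

Variable mu : 'X_{1..n} -> nat.
Hypothesis muD : forall u w, mu (u + w)%MM = mu u + mu w.
Variable rules : seq ('X_{1..n} * 'X_{1..n}).
Hypothesis lower : lowering mu rules.

Lemma lowering_step u : ~~ standard rules u -> exists2 r, r \in rules &
  exists2 v, u = (v + r.1)%MM & [/\ mdeg (v + r.2)%MM = mdeg u,
    (expo e (v + r.2) <= expo e u)%MM & mu (v + r.2)%MM < mu u].
Proof.
case/allPn => r r_in; rewrite negbK => /submK uE; exists r => //.
exists (u - r.1)%MM => //; move: uE; move: (u - r.1)%MM => v <-.
have [d le lt] := lower r_in; split; rewrite ?mdegD ?d ?muD ?ltn_add2l //.
by move: le; rewrite !lem2E !expoD !mnmDE !leq_add2l.
Qed.

Lemma standard_dominating : dominating e (standard rules).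
Proof.
move=> u; have [N] := ubnP (mu u); elim: N u => // N IHN u ltuN.
have [std_u|/lowering_step[r _ [v _ [d le lt]]]] := boolP (standard rules u).
  by exists u; rewrite lepm_refl.
have [|w [std_w wd le_w]] := IHN (v + r.2)%MM; first exact: leq_trans lt _.
by exists w; rewrite wd d; split=> //; apply: lepm_trans le.
Qed.

(** When rules strictly lower exponents they represent products that vanish in
    the fiber cone, and a word whose exponent is minimal admits no rule. *)
Lemma standard_faithful (T := standard rules) : antichain e T ->
  (forall r, r \in rules -> expo e r.1 != expo e r.2) ->
  forall u, faithful_factor e T u.
Proof.
move=> antiT strict u w w' Tw Tw' d E.
have [std|/lowering_step[r r_in [v vE [dv le _]]]] := boolP (T (w' + u)%MM).
  by apply: antiT; rewrite // E lepm_refl.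
have E' : expo e (v + r.2)%MM = expo e w.
  by apply: (normal_below standard_dominating antiT Tw); rewrite ?dv // E.
case/eqP: (strict r r_in); move: E'; rewrite E vE !expoD => /esym.
by rewrite ![(expo e v + _)%MM]addmC; apply: addIm.
Qed.

End StandardWords.

(** * The four generators *)
Section FourGenerators.

Definition mnm2 x y : 'X_{1..2} := [multinom if i == ord0 then x else y | i < 2].

Definition gens a c (i : 'I_4) : 'X_{1..2} :=
  nth 0%MM [:: mnm2 c 0; mnm2 a.+1 a; mnm2 a a.+1; mnm2 0 c] i.

Definition j0 : 'I_4 := @Ordinal 4 0 isT.
Definition j1 : 'I_4 := @Ordinal 4 1 isT.
Definition j2 : 'I_4 := @Ordinal 4 2 isT.
Definition j3 : 'I_4 := @Ordinal 4 3 isT.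

Lemma symmetric_idealE (K : fieldType) a c :
  symmetric_ideal K a a.+1 c = mon_ideal K (gens a c).
Proof.
have XE i j : (vx K ^+ i * vy K ^+ j = 'X_[mnm2 i j])%R.
  rewrite /vx /vy !mpolyXn -mpolyXD; congr 'X_[_]; apply/mnmP => k.
  rewrite mnmDE !mulmnE !mnm1E mnmE; case: k => [[|[|//]] ltk] /=;
    by rewrite ?eqE /= ?mul1n ?mul0n ?addn0.
rewrite /symmetric_ideal /mon_ideal.
have -> : enum 'I_4 = [:: j0; j1; j2; j3].
  by apply: (inj_map val_inj); rewrite val_enum_ord.
by rewrite /= -!XE !expr0 mulr1 mul1r.
Qed.

Lemma ord4P (P : 'I_4 -> Prop) : P j0 -> P j1 -> P j2 -> P j3 -> forall j, P j.
Proof.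
by move=> P0 P1 P2 P3 [[|[|[|[|//]]]] ltj];
  [move: P0 | move: P1 | move: P2 | move: P3]; congr P; apply: val_inj.
Qed.

Lemma sum4E (F : 'I_4 -> nat) : \sum_j F j = F j0 + F j1 + F j2 + F j3.
Proof.
rewrite !big_ord_recl big_ord0 addn0 !addnA.
by congr (_ + _ + _ + _); congr F; apply: val_inj.
Qed.

Definition word p q r s : 'X_{1..4} := [multinom nth 0 [:: p; q; r; s] i | i < 4].

Lemma wordE p q r s :
  (word p q r s j0 = p) * (word p q r s j1 = q) * (word p q r s j2 = r)
  * (word p q r s j3 = s).
Proof. by rewrite !mnmE. Qed.

Lemma mnm4_eq (u w : 'X_{1..4}) :
  u j0 = w j0 -> u j1 = w j1 -> u j2 = w j2 -> u j3 = w j3 -> u = w.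
Proof. by move=> *; apply/mnmP; apply: ord4P. Qed.

Lemma lem4E (u w : 'X_{1..4}) : (u <= w)%MM =
  [&& u j0 <= w j0, u j1 <= w j1, u j2 <= w j2 & u j3 <= w j3].
Proof.
apply/mnm_lepP/and4P => [le|[? ? ? ?]]; last exact: ord4P.
by split; apply: le.
Qed.

Lemma mdeg4E (w : 'X_{1..4}) : mdeg w = w j0 + w j1 + w j2 + w j3.
Proof. by rewrite mdegE sum4E. Qed.

Lemma expo_gens0 a c w :
  expo (gens a c) w ord0 = c * w j0 + a.+1 * w j1 + a * w j2.
Proof. by rewrite expoE sum4E /= !mnmE /= addn0. Qed.

Lemma expo_gens1 a c w :
  expo (gens a c) w ord_max = a * w j1 + a.+1 * w j2 + c * w j3.
Proof. by rewrite expoE sum4E /= !mnmE /=. Qed.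

Lemma weight_mnm2 r s x y : weight r s (mnm2 x y) = r * x + s * y.
Proof. by rewrite /weight !mnmE. Qed.

(** Comparison of leading digits in base c, allowing an overlap of the remainders
    by less than c. *)
Lemma digit_le c p p' i i' : c * p + i <= c * p' + i' -> i' < c + i -> p <= p'.
Proof.
move=> le lt; rewrite leqNgt; apply/negP => /(leq_mul (leqnn c)); rewrite mulnS; lia.
Qed.

Lemma digit_lt c p p' i i' : c * p + i <= c * p' + i' -> i' < i -> p < p'.
Proof.
move=> le lt; rewrite ltnNge; apply/negP => /(leq_mul (leqnn c)); lia.
Qed.

Section Small.
Variables a c : nat.
Hypotheses (a0 : 0 < a) (ltac : a.+1 < c) (lec : c <= 2 * a).

Definition rules_small :=
  [:: (word 0 2 0 0, word 1 0 0 1); (word 0 1 1 0, word 1 0 0 1);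
      (word 0 0 2 0, word 1 0 0 1)].

Lemma lowering_small : lowering (gens a c) (fun w => w j1 + w j2) rules_small.
Proof.
move=> r; rewrite !inE => /or3P[] /eqP ->;
  rewrite !mdeg4E lem2E !expo_gens0 !expo_gens1 !wordE; split=> //; lia.
Qed.

(** With at most one letter among z2, z3, the x-degree is c p plus 0, a + 1 or a,
    all less than c, and similarly for the y-degree.  So p and s can be compared
    as leading digits, and the equality of degrees decides. *)
Lemma antichain_small : antichain (gens a c) (standard rules_small).
Proof.
move=> w w'; rewrite /standard /= !lem4E !wordE !mdeg4E lem2E !expo_gens0 !expo_gens1.
move: (w j0) (w j1) (w j2) (w j3) (mnm4_eq (u := w) (w := w')) => p q r s.
move: (w' j0) (w' j1) (w' j2) (w' j3) => p' q' r' s' eqw Tw Tw' d /andP[le_x le_y].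
suff [] : [/\ p = p', q = q', r = r' & s = s'] by exact: eqw.
have qr : q + r <= 1 by lia.
have qr' : q' + r' <= 1 by lia.
have [b bE] : exists b, b = a.+1 by exists a.+1.
rewrite -bE -!addnA in le_x; rewrite -bE ![_ + c * _]addnC in le_y.
have := digit_le le_x; have := digit_lt le_x.
have := digit_le le_y; have := digit_lt le_y.
move: qr qr' Tw Tw' d {le_x le_y eqw}.
by case: q r q' r' => [|[|q]] [|[|r]] [|[|q']] [|[|r']] //;
  rewrite ?muln0 ?muln1 ?addn0 ?add0n => *; split; lia.
Qed.

End Small.

Section Balanced.
Variable a : nat.
Let c := (2 * a).+1.

Definition rules_balanced :=
  [:: (word 0 1 1 0, word 1 0 0 1); (word 0 a.+1 0 0, word 1 0 a 0);
      (word 0 0 a.+1 0, word 0 a 0 1)].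

Lemma lowering_balanced : lowering (gens a c) (fun w => w j1 + w j2) rules_balanced.
Proof.
move=> r; rewrite !inE => /or3P[] /eqP ->;
  rewrite !mdeg4E lem2E !expo_gens0 !expo_gens1 !wordE /c; split=> //; nia.
Qed.

(** All words of degree k have total degree c k, so comparable exponents are
    equal.  Twice the x-degree is c (2p + q + r) + (q - r), where |q - r| <= a,
    which determines both parts. *)
Lemma antichain_balanced : antichain (gens a c) (standard rules_balanced).
Proof.
move=> w w'; rewrite /standard /= !lem4E !wordE !mdeg4E lem2E !expo_gens0 !expo_gens1.
move: (w j0) (w j1) (w j2) (w j3) (mnm4_eq (u := w) (w := w')) => p q r s.
move: (w' j0) (w' j1) (w' j2) (w' j3) => p' q' r' s' eqw Tw Tw' d /andP[le_x le_y].
have eq_c : c * (p + q + r + s) = c * (p' + q' + r' + s') by rewrite d.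
have le1 : c * (2 * p + q + r) + (q + r') <= c * (2 * p' + q' + r') + (q' + r).
  by move: le_x; rewrite /c; lia.
have le2 : c * (2 * p' + q' + r') + (q' + r) <= c * (2 * p + q + r) + (q + r').
  by move: le_y eq_c; rewrite /c; lia.
have := digit_le le1; have := digit_le le2; rewrite /c => m1 m2.
have eqM : 2 * p + q + r = 2 * p' + q' + r' by lia.
have eq_qr : q + r' = q' + r by move: le1 le2; rewrite eqM; lia.
by apply: eqw; lia.
Qed.

End Balanced.

Section Large.
Variables a k : nat.
Hypothesis a0 : 0 < a.
Let c := (2 * a).+1 + k.+1.

Definition rules_large :=
  [:: (word 1 0 0 1, word 0 1 1 0); (word 1 0 a 0, word 0 a.+1 0 0);
      (word 0 a 0 1, word 0 0 a.+1 0)].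

Lemma lowering_large : lowering (gens a c) (fun w => w j0 + w j3) rules_large.
Proof.
move=> r; rewrite !inE => /or3P[] /eqP ->;
  rewrite !mdeg4E lem2E !expo_gens0 !expo_gens1 !wordE /c; split=> //; nia.
Qed.

Lemma strict_large r : r \in rules_large -> expo (gens a c) r.1 != expo (gens a c) r.2.
Proof.
rewrite !inE => /or3P[] /eqP ->; apply/eqP => /mnmP E; have := E ord0; have := E ord_max;
  rewrite !expo_gens0 !expo_gens1 !wordE /c; nia.
Qed.

Lemma standard_large w : standard rules_large w =
  [&& (w j0 == 0) || (w j3 == 0), (w j0 == 0) || (w j2 < a) & (w j3 == 0) || (w j1 < a)].
Proof. by rewrite /standard /= !lem4E !wordE; lia. Qed.

(** [sumE], [edge] and [edge'] evaluate the three linear forms that are minimal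
    along the edges z2 z3, z1 z2 and z3 z4 of the Newton polygon.  If w' lies
    near one edge, the form of that edge shows that the smaller w is at most as
    far from it, and the two words are then compared along the edge. *)
Lemma antichain_large : antichain (gens a c) (standard rules_large).
Proof.
move=> w w'; rewrite !standard_large !mdeg4E lem2E !expo_gens0 !expo_gens1.
move: (w j0) (w j1) (w j2) (w j3) (mnm4_eq (u := w) (w := w')) => p q r s.
move: (w' j0) (w' j1) (w' j2) (w' j3) => p' q' r' s' eqw Tw Tw' d /andP[le_x le_y].
suff [] : [/\ p = p', q = q', r = r' & s = s'] by exact: eqw.
have sumE x y z t : c * x + a.+1 * y + a * z + (a * y + a.+1 * z + c * t)
    = (2 * a).+1 * (x + y + z + t) + k.+1 * (x + t) by rewrite /c; ring.
have le_ps : p + s <= p' + s'.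
  have := leq_add le_x le_y; rewrite !sumE d leq_add2l leq_pmul2l //.
have edge x y z t : a * (c * x + a.+1 * y + a * z) + (a + k.+1) * (a * y + a.+1 * z + c * t)
    = a * c * (x + y + z + t) + k.+1 * (z + c * t) by rewrite /c; ring.
have edge' x y z t : (a + k.+1) * (c * x + a.+1 * y + a * z) + a * (a * y + a.+1 * z + c * t)
    = a * c * (x + y + z + t) + k.+1 * (y + c * x) by rewrite /c; ring.
have le_edge := leq_add (leq_mul (leqnn a) le_x) (leq_mul (leqnn (a + k.+1)) le_y).
have le_edge' := leq_add (leq_mul (leqnn (a + k.+1)) le_x) (leq_mul (leqnn a) le_y).
move: le_edge le_edge'; rewrite !edge !edge' d !leq_add2l !leq_pmul2l // => le_r le_q.
have c_gt : a < c by rewrite /c; lia.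
have [p'0|p'0] := posnP p'; have [s'0|s'0] := posnP s'.
- have p0 : p = 0 by lia.
  have s0 : s = 0 by lia.
  by move: le_r le_q; rewrite p0 s0 p'0 s'0 !muln0 !addn0 => ? ?; split; lia.
- have p0 : p = 0 by case: (p) le_q => // x; rewrite p'0 mulnS muln0; lia.
  have le_qr : q + r <= q' + r'.
    move: le_x; rewrite p0 p'0 !muln0 !add0n => le_x.
    by apply: (@digit_le a _ _ q q'); lia.
  have [x xE] : exists x, s = s' + x by exists (s - s'); lia.
  suff x0 : x = 0 by move: le_q; rewrite p0 p'0 !muln0 => ?; split; lia.
  move: le_y le_q; rewrite p0 p'0 xE !muln0 !addn0 => le_y le_q.
  have : (c - a) * x <= 0.
    have qrE : q' + r' = q + r + x by lia.
    have : a * (q' + r') = a * (q + r) + a * x by rewrite qrE; lia.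
    by rewrite mulnBl; lia.
  by rewrite leqn0 muln_eq0; lia.
- have s0 : s = 0 by case: (s) le_r => // x; rewrite s'0 mulnS muln0; lia.
  have le_qr : q + r <= q' + r'.
    move: le_y; rewrite s0 s'0 !muln0 !addn0 => le_y.
    by apply: (@digit_le a _ _ r r'); lia.
  have [x xE] : exists x, p = p' + x by exists (p - p'); lia.
  suff x0 : x = 0 by move: le_r; rewrite s0 s'0 !muln0 => ?; split; lia.
  move: le_x le_r; rewrite s0 s'0 xE !muln0 !addn0 => le_x le_r.
  have : (c - a) * x <= 0.
    have qrE : q' + r' = q + r + x by lia.
    have : a * (q' + r') = a * (q + r) + a * x by rewrite qrE; lia.
    by rewrite mulnBl; lia.
  by rewrite leqn0 muln_eq0; lia.
- by lia.
Qed.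

(** The words are z1, z3^a, z4, z2^a. *)
Lemma large_regular_pair (K : fieldType) : regular_pair
  (to_fiber_cone (mono K (gens a c) (word 1 0 0 0) + mono K (gens a c) (word 0 0 a 0))%R)
  (to_fiber_cone (mono K (gens a c) (word 0 0 0 1) + mono K (gens a c) (word 0 a 0 0))%R).
Proof.
pose mu (w : 'X_{1..4}) := w j0 + w j3.
have muD (u w : 'X_{1..4}) : mu (u + w)%MM = mu u + mu w.
  by rewrite /mu !mnmDE; lia.
apply: (@binomial_regular_pair K _ _ (standard rules_large)).
- exact: (standard_dominating (mu := mu) muD lowering_large).
- exact: antichain_large.
- exact: (standard_faithful (mu := mu) muD lowering_large antichain_large strict_large).
- exact: standard_down.
all: move=> w; rewrite ?standard_large ?lem4E ?mnmDE !wordE; lia.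
Qed.

End Large.

Section FreePair.
Variables (a c : nat).

Lemma outer_regular_pair (K : fieldType) rules mu :
    (forall u w : 'X_{1..4}, mu (u + w)%MM = mu u + mu w) ->
    lowering (gens a c) mu rules -> antichain (gens a c) (standard rules) ->
    (forall r, r \in rules -> r.1 j0 = 0 /\ r.1 j3 = 0) ->
  regular_pair (to_fiber_cone (mono K (gens a c) (word 1 0 0 0)))
               (to_fiber_cone (mono K (gens a c) (word 0 0 0 1))).
Proof.
move=> muD lower antiT lead0.
apply: (@free_regular_pair K _ _ (standard rules)) => //.
- exact: (standard_dominating (mu := mu) muD lower).
- move=> w; apply: eq_in_all => r /lead0[r0 r3].
  by rewrite !lem4E !mnmDE !wordE r0 r3 !leq0n !addn0.
- move=> w; apply: eq_in_all => r /lead0[r0 r3].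
  by rewrite !lem4E !mnmDE !wordE r0 r3 !leq0n !addn0.
by move=> w; rewrite !lem4E !mnmDE !wordE; lia.
Qed.

End FreePair.

Lemma supports_gens r s E a c : 0 < r -> 0 < s ->
    E <= r * c -> E <= r * a.+1 + s * a -> E <= r * a + s * a.+1 -> E <= s * c ->
  supports (gens a c) r s E.
Proof.
move=> r0 s0 E0 E1 E2 E3; split=> //.
by apply: ord4P; rewrite /= weight_mnm2 ?muln0 ?addn0 ?add0n.
Qed.

Lemma supports_deg a c : 0 < a -> 0 < c -> supports (gens a c) 1 1 1.
Proof. by move=> a0 c0; apply: supports_gens; lia. Qed.

(** All generators lie on or above the edge joining x^c and y^c.  The prime of
    that edge is followed by the prime of the vertex y^c; the weight (a+2, a+1)
    is tilted just enough to isolate it. *)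
Lemma cohen_macaulay_le (K : fieldType) T a c x y :
    0 < a -> a.+1 < c -> c <= (2 * a).+1 ->
    dominating (gens a c) T -> antichain (gens a c) T ->
    x \in fiber_cone_plus (mon_ideal K (gens a c)) ->
    y \in fiber_cone_plus (mon_ideal K (gens a c)) -> regular_pair x y ->
  graded_cohen_macaulay (fiber_cone_plus (mon_ideal K (gens a c))).
Proof.
move=> a0 ltac lec domT antiT xP yP xy.
have c0 : 0 < c by lia.
apply: (@fiber_cone_cohen_macaulay K _ _ T domT antiT (supports_deg a0 c0)
  x y 1 1 c a.+2 a.+1 (a.+1 * c) j0 j3 xP yP xy).
- by apply: supports_gens; lia.
- by apply: supports_gens => //; nia.
- by apply: ord4P; rewrite /= !weight_mnm2; nia.
- by rewrite /= weight_mnm2; lia.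
- by rewrite /= weight_mnm2; apply/eqP; nia.
- by rewrite /= weight_mnm2; lia.
Qed.

(** The two inner generators span an edge, whose vertex x^a y^(a+1) is isolated
    by the weight (a+2, a+1). *)
Lemma cohen_macaulay_gt (K : fieldType) T a c x y :
    0 < a -> (2 * a).+1 < c ->
    dominating (gens a c) T -> antichain (gens a c) T ->
    x \in fiber_cone_plus (mon_ideal K (gens a c)) ->
    y \in fiber_cone_plus (mon_ideal K (gens a c)) -> regular_pair x y ->
  graded_cohen_macaulay (fiber_cone_plus (mon_ideal K (gens a c))).
Proof.
move=> a0 ltac domT antiT xP yP xy.
have c0 : 0 < c by lia.
apply: (@fiber_cone_cohen_macaulay K _ _ T domT antiT (supports_deg a0 c0)
  x y 1 1 (2 * a).+1 a.+2 a.+1 (a.+2 * a + a.+1 * a.+1) j1 j2 xP yP xy).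
- by apply: supports_gens; lia.
- by apply: supports_gens => //; nia.
- by apply: ord4P; rewrite /= !weight_mnm2; nia.
- by rewrite /= weight_mnm2; lia.
- by rewrite /= weight_mnm2; apply/eqP; nia.
- by rewrite /= weight_mnm2; lia.
Qed.

End FourGenerators.

Theorem corollary3p8 (K : fieldType) (a b c : nat)
    (ha : 0 < a) (hab : a < b) (hbc : b < c) (hb : b = a.+1) :
  graded_cohen_macaulay (fiber_cone_plus (symmetric_ideal K a b c)).
Proof.
subst b; rewrite symmetric_idealE.
pose mu12 (w : 'X_{1..4}) := w j1 + w j2.
have mu12D (u w : 'X_{1..4}) : mu12 (u + w)%MM = mu12 u + mu12 w.
  by rewrite /mu12 !mnmDE; lia.
pose mu03 (w : 'X_{1..4}) := w j0 + w j3.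
have mu03D (u w : 'X_{1..4}) : mu03 (u + w)%MM = mu03 u + mu03 w.
  by rewrite /mu03 !mnmDE; lia.
have [lec|ltc] := leqP c (2 * a).
  have lower := lowering_small ha hbc lec; have anti := antichain_small ha hbc lec.
  apply: (cohen_macaulay_le ha hbc (leqW lec) (standard_dominating (mu := mu12) mu12D lower) anti _ _
    (outer_regular_pair K (mu := mu12) mu12D lower anti _)).
  - by apply: mono_fiber_cone_plus; rewrite mdeg4E !wordE.
  - by apply: mono_fiber_cone_plus; rewrite mdeg4E !wordE.
  by move=> r; rewrite !inE => /or3P[] /eqP ->; rewrite !wordE.
have [lec|{}ltc] := leqP c (2 * a).+1.
  have cE : c = (2 * a).+1 by lia.
  subst c.
  have lower := @lowering_balanced a; have anti := @antichain_balanced a.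
  apply: (cohen_macaulay_le ha hbc lec (standard_dominating (mu := mu12) mu12D lower) anti _ _
    (outer_regular_pair K (mu := mu12) mu12D lower anti _)).
  - by apply: mono_fiber_cone_plus; rewrite mdeg4E !wordE.
  - by apply: mono_fiber_cone_plus; rewrite mdeg4E !wordE.
  by move=> r; rewrite !inE => /or3P[] /eqP ->; rewrite !wordE.
have [k cE] : exists k, c = (2 * a).+1 + k.+1 by exists (c - (2 * a).+2); lia.
subst c.
apply: (cohen_macaulay_gt ha ltc
  (standard_dominating (mu := mu03) mu03D (@lowering_large a k ha)) (antichain_large ha)
  _ _ (large_regular_pair k ha K)).
  by rewrite to_fiber_coneD; apply: fiber_cone_plusD;
    apply: mono_fiber_cone_plus; rewrite mdeg4E !wordE; lia.
by rewrite to_fiber_coneD; apply: fiber_cone_plusD;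
  apply: mono_fiber_cone_plus; rewrite mdeg4E !wordE; lia.
Qed.
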